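(* Let $\mu$ be a translation-invariant Gibbs measure on $\Omega=\{0,1\}^{\mathbb{Z}^d}$ whose Dobrushin matrix $$C_{ij}=\sup_{x\in\{0,1\},\,\sigma\in\Omega}\Big|\mu\big(\sigma_i=x\,|\,(\sigma^j)_{\mathbb{Z}^d\setminus\{i\}}\big)-\mu\big(\sigma_i=x\,|\,\sigma_{\mathbb{Z}^d\setminus\{i\}}\big)\Big|$$ satisfies $\sup_i\sum_jC_{ij}<1$. Let $(S_t)_{t\ge0}$ be the semigroup of the heat bath dynamics for $\mu$, i.e. the spin-flip process with rates $c(i,\sigma)=\mu(\sigma^i(i)\,|\,\sigma_{\mathbb{Z}^d\setminus\{i\}})$. Then there exist constants $c>0$ and $\alpha>0$ (depending on $\mu$ but not on $t$ or $f$) such that for all $t\geq0$ and all bounded measurable $f:\Omega\to\mathbb{R}$, $$\mathbb{E}_\mu\left(e^{S_tf-\mathbb{E}_\mu(f)}\right)\leq e^{c\,e^{-\alpha t}\,\|\delta f\|_2^2}.$$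
   Context: $\Omega=\{0,1\}^{\mathbb{Z}^d}$ with product topology and Borel $\sigma$-field. $\sigma^i$ is $\sigma$ flipped at site $i$ (so $\sigma^i(i)=1-\sigma(i)$). $\delta_if=\sup_\eta(f(\eta^i)-f(\eta))$, $\|\delta f\|_2=(\sum_i(\delta_if)^2)^{1/2}$ (the bound is vacuous if this is infinite). Gibbs measure: shift $(\tau_x\sigma)(y)=\sigma(y-x)$. A translation-invariant interaction is a function $U$ of finite subsets $A\subset\mathbb{Z}^d$ and $\sigma\in\Omega$ such that $U(A,\cdot)$ depends only on $\sigma_A$, $U(A+x,\tau_x\sigma)=U(A,\sigma)$, and $\sum_{A\ni0}\sup_\sigma|U(A,\sigma)|<\infty$. With $H^\zeta_\Lambda(\sigma)=\sum_{A\cap\Lambda\neq\emptyset}U(A,\sigma_\Lambda\zeta_{\Lambda^c})$, $\mu$ is a Gibbs measure for $U$ if for every finite $\Lambda$ and $\mu$-a.e. $\zeta$ the conditional distribution of $\sigma_\Lambda$ given $\sigma_{\Lambda^c}=\zeta_{\Lambda^c}$ is proportional to $e^{-H^\zeta_\Lambda(\sigma)}$. Conditional probabilities $\mu(\sigma_i=x\,|\,\sigma_{\mathbb{Z}^d\setminus\{i\}})$ are taken in this continuous version; $\mu(x\,|\,\sigma_{\mathbb{Z}^d\setminus\{i\}})$ is the conditional probability of spin value $x$ at $i$ given $\sigma$ outside $i$. The spin-flip process with rates $c(i,\sigma)$ is the Markov process with generator $Lf(\sigma)=\sum_ic(i,\sigma)(f(\sigma^i)-f(\sigma))$ on functions depending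 on finitely many sites; $S_tf(\sigma)=\mathbb{E}_\sigma f(\sigma_t)$. *)

(* Defs.v *)
From HB Require Import structures.
From mathcomp Require Import all_boot all_order all_algebra.
From mathcomp Require Import finmap.
From mathcomp Require Import all_classical all_reals all_analysis.

Set Implicit Arguments.
Unset Strict Implicit.
Unset Printing Implicit Defensive.
Import Order.TTheory GRing.Theory Num.Theory.
Import numFieldNormedType.Exports.
Local Open Scope classical_set_scope.
Local Open Scope ring_scope.

Notation site d := ('rV[int]_d).

Definition config (d : nat) := site d -> bool.

(* Product of the discrete topologies on bool, with its Borel sigma-field. *)
HB.instance Definition _ (d : nat) :=
  Topological.copy (config d) (prod_topology (fun _ : site d => bool)).
HB.instance Definition _ (d : nat) := isPointed.Build (config d) (fun=> false).
HB.instance Definition _ (d : nat) :=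
  Measurable.copy (config d) (g_sigma_algebraType (@open (config d))).

Definition flip d (i : site d) (sigma : config d) : config d :=
  fun j => if j == i then ~~ sigma i else sigma j.

Definition translate d (x : site d) (sigma : config d) : config d :=
  fun y => sigma (y - x).

Definition agree_on d (A : {fset site d}) (sigma eta : config d) : Prop :=
  forall i, i \in A -> sigma i = eta i.

(* The configuration xi_Lambda zeta_{Lambda^c}. *)
Definition glue d (Lambda : {fset site d}) (xi : {ffun Lambda -> bool})
    (zeta : config d) : config d :=
  fun i => if insub i is Some j then xi j else zeta i.

Definition config_restr d (Lambda : {fset site d}) (sigma : config d) :
    {ffun Lambda -> bool} :=
  [ffun j : Lambda => sigma (val j)].

Section Gibbs.
Variables (R : realType) (d : nat).
Implicit Types (U : {fset site d} -> config d -> R) (Lambda : {fset site d}).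

Definition translation_invariant_interaction U : Prop :=
  [/\ forall A sigma eta, agree_on A sigma eta -> U A sigma = U A eta,
      forall A x sigma,
        U [fset (y + x)%R | y in A]%fset (translate x sigma) = U A sigma
    & (\esum_(A in [set A : {fset site d} | 0%R \in A])
         ereal_sup [set `|U A sigma|%:E | sigma in [set: config d]]
       < +oo)%E].

(* Sum of an absolutely summable real family over a possibly infinite set;
   esum alone is only meaningful for nonnegative families. *)
Definition rsum (T : choiceType) (D : set T) (a : T -> R) : R :=
  fine (\esum_(t in D) (EFin \o a)^\+ t - \esum_(t in D) (EFin \o a)^\- t)%E.

Definition hamiltonian U Lambda (zeta : config d)
    (xi : {ffun Lambda -> bool}) : R :=
  rsum [set A : {fset site d} | (A `&` Lambda)%fset != fset0]
       (fun A => U A (glue xi zeta)).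

Definition gibbs_weight U Lambda (zeta : config d)
    (xi : {ffun Lambda -> bool}) : R :=
  expR (- hamiltonian U zeta xi) /
  \sum_(xi' : {ffun Lambda -> bool}) expR (- hamiltonian U zeta xi').

(* g is a version of the conditional probability of A given the
   sub-sigma-field G. *)
Definition cond_prob_version (disp : measure_display)
    (T : measurableType disp) (mu : probability T R)
    (G : set (set T)) (A : set T) (g : T -> R) : Prop :=
  [/\ forall B : set R, measurable B -> G (g @^-1` B),
      mu.-integrable [set: T] (EFin \o g)
    & forall E, G E -> (\int[mu]_(x in E) (g x)%:E = mu (A `&` E))%E].

(* The sigma-field generated by the coordinates outside Lambda. *)
Definition outside Lambda : set (set (config d)) :=
  <<s [set E | exists2 j, j \notin Lambda
                        & E = [set sigma : config d | sigma j]] >>.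

Definition gibbs_measure U (mu : probability (config d) R) : Prop :=
  forall Lambda (xi : {ffun Lambda -> bool}),
    exists2 g : config d -> R,
      cond_prob_version mu (outside Lambda)
        [set sigma | config_restr Lambda sigma = xi] g
    & \forall zeta \ae mu, g zeta = gibbs_weight U zeta xi.

Definition translation_invariant (mu : probability (config d) R) : Prop :=
  forall (x : site d) (A : set (config d)), measurable A ->
    mu (translate x @^-1` A) = mu A.

(* The continuous version of mu(sigma_i = x | sigma outside i) for a Gibbs
   measure mu of the interaction U. *)
Definition site_cond U (i : site d) (x : bool) (sigma : config d) : R :=
  gibbs_weight U sigma [ffun _ : [fset i]%fset => x].

Definition dobrushin_matrix U (i j : site d) : \bar R :=
  ereal_sup [set `|site_cond U i p.1 (flip j p.2) - site_cond U i p.1 p.2|%:E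
            | p in [set: bool * config d]].

Definition dobrushin_condition U : Prop :=
  (ereal_sup [set \esum_(j in [set: site d]) dobrushin_matrix U i j
             | i in [set: site d]] < 1)%E.

Definition heat_bath_rate U (i : site d) (sigma : config d) : R :=
  site_cond U i (flip i sigma i) sigma.

End Gibbs.

Section SpinFlip.
Variables (R : realType) (d : nat).

Definition local_fun (f : config d -> R) : Prop :=
  exists A : {fset site d},
    forall sigma eta, agree_on A sigma eta -> f sigma = f eta.

(* The \sum_(i \in _) below is the sum of a finitely supported family; only
   finitely many summands are nonzero when f is local. *)
Definition spin_flip_generator (c : site d -> config d -> R)
    (f : config d -> R) (sigma : config d) : R :=
  \sum_(i \in [set: site d]) c i sigma * (f (flip i sigma) - f sigma).

(* P t sigma is the law at time t of the process started from sigma; only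
   the times t >= 0 are meaningful. *)
Definition semigroup (P : R -> R.-pker (config d) ~> (config d)) (t : R)
    (f : config d -> R) (sigma : config d) : R :=
  fine (\int[P t sigma]_eta (f eta)%:E)%E.

Definition feller_transition (P : R -> R.-pker (config d) ~> (config d)) :
    Prop :=
  [/\ forall (sigma : config d) (A : set (config d)), measurable A ->
        P 0 sigma A = \d_sigma A,
      forall s t : R, 0 <= s -> 0 <= t ->
        forall (sigma : config d) (A : set (config d)), measurable A ->
        (P (s + t)%R sigma A = \int[P s sigma]_eta P t eta A)%E,
      forall t : R, 0 <= t -> forall f : config d -> R,
        continuous f -> continuous (semigroup P t f)
    & forall f : config d -> R, continuous f -> forall e : R, 0 < e ->
        \forall t \near 0^'+, forall sigma,
          `|semigroup P t f sigma - f sigma| <= e].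

(* f belongs to the domain of the (sup-norm) generator of P, and its image
   is g. *)
Definition generator_graph (P : R -> R.-pker (config d) ~> (config d))
    (f g : config d -> R) : Prop :=
  forall e : R, 0 < e -> \forall t \near 0^'+, forall sigma,
    `|(semigroup P t f sigma - f sigma) / t - g sigma| <= e.

Definition spin_flip_process (c : site d -> config d -> R)
    (P : R -> R.-pker (config d) ~> (config d)) : Prop :=
  feller_transition P /\
  forall f : config d -> R, local_fun f ->
    generator_graph P f (spin_flip_generator c f).

Definition delta (f : config d -> R) (i : site d) : \bar R :=
  ereal_sup [set (f (flip i eta) - f eta)%:E | eta in [set: config d]].

Definition delta_norm2 (f : config d -> R) : \bar R :=
  ((\esum_(i in [set: site d]) delta f i ^+ 2) `^ 2^-1)%E.

End SpinFlip.

(* Main.v *)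
(* Let K_i resample the spin at site i from its conditional law, and let
   K = 1 + e \sum_(i in F) (K_i - 1) for a finite F and a small e > 0.  The
   single-site DLR equations say that mu is K_i-invariant, so convexity of exp
   gives (1 - e \sum_(i in F) (delta_i f)^2) E[exp f] <= E[exp (K f)].  By
   translation invariance the row sums and the column sums of the Dobrushin
   matrix are all at most some q < 1, so K contracts
   \sum_(i in F) (delta_i f)^2 by the factor 1 - e (1 - q).  The iterates K^n
   with e = t / n converge to S_t, uniformly on local functions and then, by
   density and invariance, in L^1(mu) on bounded measurable ones.  Iterating the
   inequality therefore bounds E[exp (S_t f)] by
   exp (2 / (1 - q) e^(- (1 - q) t) |delta f|_2^2) E[exp (S_T (S_t f))] for every T,
   and S_T (S_t f) tends to E[f] in L^1(mu) as T grows. *)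

Require Import Defs.
From HB Require Import structures.
From mathcomp Require Import all_boot all_order all_algebra.
From mathcomp Require Import finmap.
From mathcomp Require Import all_classical all_reals all_analysis.
From mathcomp Require Import measurable_realfun ring lra.

Set Implicit Arguments.
Unset Strict Implicit.
Unset Printing Implicit Defensive.
Import Order.TTheory GRing.Theory Num.Theory.
Import numFieldNormedType.Exports.
Local Open Scope classical_set_scope.
Local Open Scope ring_scope.

(** * Bounded measurable functions and their expectations *)

(** Only finitely many sites are resampled because [step] is a positive operator only when $e|F| \le
    1$, and positivity is what makes it contract both the sup norm and $L^1(\mu)$. The price is that
    nothing contracts outside [F], where oscillation leaks in from [F]. The leak is controlled by a
    summable $w \ge u$ with $C^T w \le w$: up to a factor $e^t$ it dominates the oscillations of all
    iterates at all sites, for every [F] and every fine mesh, so its tail disposes of the complement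
    of a large [F]. A bounded measurable $f$ need not be a uniform limit of local functions, and an
    $L^1$ limit does not transmit pointwise oscillation bounds to $S_t f$. The exponential
    inequality is therefore iterated along the discrete evolution only, where oscillations are
    explicit; $S_t f$ enters through exponential moments, which are Lipschitz in $L^1(\mu)$ on
    uniformly bounded functions. *)

Lemma eq_approx (R : realType) (x y : R) :
  (forall e, 0 < e -> exists z, `|x - z| <= e /\ `|y - z| <= e) -> x = y.
Proof.
move=> H; apply/eqP; rewrite -subr_eq0 -normr_le0.
apply/ler_addgt0Pr => e e0; rewrite add0r (splitr e).
have [|z [xz yz]] := H (e / 2); first by rewrite divr_gt0.
by apply: le_trans (ler_distD z _ _) _; apply: lerD => //; rewrite distrC.
Qed.

Section BoundedMeasurable.
Context {disp : measure_display} {T : measurableType disp} {R : realType}.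
Implicit Types (f g : T -> R) (m : {measure set T -> \bar R}).

(** The bound is required at every point because the same function is integrated against [mu] and
    against all the laws [P t s]. *)
Definition bmeas f := measurable_fun setT f /\ exists M, forall x, `|f x| <= M.

Lemma bmeas_cst (a : R) : bmeas (fun=> a).
Proof. by split; [exact: measurable_cst|exists `|a|]. Qed.

Lemma bmeasD f g : bmeas f -> bmeas g -> bmeas (fun x => f x + g x).
Proof.
move=> [mf [M fM]] [mg [N gN]]; split; first exact: measurable_funD.
by exists (M + N) => x; rewrite (le_trans (ler_normD _ _))// lerD.
Qed.

Lemma bmeasM f g : bmeas f -> bmeas g -> bmeas (fun x => f x * g x).
Proof.
move=> [mf [M fM]] [mg [N gN]]; split; first exact: measurable_funM.
by exists (M * N) => x; rewrite normrM ler_pM.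
Qed.

Lemma bmeasZ (a : R) f : bmeas f -> bmeas (fun x => a * f x).
Proof. exact/bmeasM/bmeas_cst. Qed.

Lemma bmeasB f g : bmeas f -> bmeas g -> bmeas (fun x => f x - g x).
Proof.
move=> [mf [M fM]] [mg [N gN]]; split; first exact: measurable_funB.
by exists (M + N) => x; rewrite (le_trans (ler_normB _ _))// lerD.
Qed.

Lemma bmeas_norm f : bmeas f -> bmeas (fun x => `|f x|).
Proof.
move=> [mf [M fM]]; split; first exact: (measurableT_comp (@normr_measurable _ _)).
by exists M => x; rewrite normr_id.
Qed.

Lemma bmeas_expR f : bmeas f -> bmeas (fun x => expR (f x)).
Proof.
move=> [mf [M fM]]; split; first exact: measurableT_comp.
exists (expR M) => x; rewrite ger0_norm ?expR_ge0// ler_expR.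
exact: le_trans (ler_norm _) (fM x).
Qed.

Lemma bmeas_indic (A : set T) : measurable A -> bmeas (\1_A : T -> R).
Proof.
move=> mA; split; first exact: measurable_indic.
by exists 1 => x; rewrite indicE; case: (_ \in _); rewrite ?normr1 ?normr0.
Qed.

Lemma bmeas_sum (I : Type) (r : seq I) (P : pred I) (F : I -> T -> R) :
  (forall i, bmeas (F i)) -> bmeas (fun x => \sum_(i <- r | P i) F i x).
Proof.
move=> bF; elim: r => [|i r IH].
  by under eq_fun do rewrite big_nil; exact: bmeas_cst.
under eq_fun do rewrite big_cons.
by case: (P i) => //; exact: bmeasD.
Qed.

Lemma bmeas_ulim f :
  (forall e : R, 0 < e -> exists2 g, bmeas g & forall x, `|f x - g x| <= e) ->
  bmeas f.
Proof.
move=> H; split; last first.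
  have [g [_ [M gM]] fg] := H 1 ltr01; exists (1 + M) => x.
  by rewrite -(subrK (g x) (f x)) (le_trans (ler_normD _ _))// lerD.
have /choice[g Hg] : forall n : nat, exists g,
    bmeas g /\ forall x, `|f x - g x| <= n.+1%:R^-1.
  by move=> n; have [g ? ?] := H n.+1%:R^-1 ltac:(by []); exists g.
apply: (@measurable_fun_cvg _ _ _ setT g).
  by move=> n; exact: (Hg n).1.1.
move=> x _; apply/cvgrPdist_le => e e0.
near=> n; apply: le_trans ((Hg n).2 x) _; apply/ltW.
by near: n; exact: (near_infty_natSinv_lt (PosNum e0)).
Unshelve. all: by end_near.
Qed.

(** A bounded measurable function is a uniform limit of finite combinations of indicators of level
    sets. Facts stated for events, such as the DLR equations, the Chapman-Kolmogorov identity or the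
    measurability of a kernel, thereby extend to functions. *)
Lemma bmeas_ind (Q : (T -> R) -> Prop) :
  (forall A, measurable A -> Q \1_A) ->
  (forall a f g, bmeas f -> bmeas g -> Q f -> Q g ->
     Q (fun x => a * f x + g x)) ->
  (forall f, bmeas f ->
     (forall e : R, 0 < e ->
        exists g, [/\ bmeas g, Q g & forall x, `|f x - g x| <= e]) -> Q f) ->
  forall f, bmeas f -> Q f.
Proof.
move=> Q1 Qlin Qlim.
have Qcst a : Q (fun=> a).
  have -> : (fun=> a) = (fun x => (a - 1) * \1_setT x + \1_setT x) :> (T -> R).
    by apply/funext => x; rewrite indicE in_setT mulr1 subrK.
  by apply: Qlin; (exact: bmeas_indic || exact: Q1).
(* Peeling off the level set [e <= f] lowers the range of [f] by [e]. *)
have step n (e : R) f : 0 < e -> bmeas f -> (forall x, 0 <= f x <= n%:R * e) ->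
    exists g, [/\ bmeas g, Q g & forall x, 0 <= g x <= f x /\ f x <= g x + e].
  move=> e0; elim: n f => [|n IH] f bf f_rng.
    exists (fun=> 0); split; [exact: bmeas_cst|exact: Qcst|move=> x].
    by have /andP[-> fx] := f_rng x; split => //; rewrite mul0r in fx; lra.
  pose A := [set x | e <= f x].
  have mA : measurable A.
    have := bf.1 measurableT `[e, +oo[%classic (measurable_itv _).
    by rewrite setTI; congr measurable; apply/seteqP; split => x /=;
      rewrite in_itv/= andbT.
  pose f' x := Num.max (f x - e) 0.
  have bf' : bmeas f'.
    split; first by apply: measurable_maxr => //;
      exact: measurable_funB bf.1 (measurable_cst _).
    exists (n%:R * e) => x; rewrite /f' maxEle.
    have /andP[f0] := f_rng x; rewrite -natr1 mulrDl mul1r => fN.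
    have ne0 : 0 <= n%:R * e by rewrite mulr_ge0// ltW.
    by case: (leP (f x - e) 0) => ?; rewrite ?normr0 ?ger0_norm//; lra.
  have [x|g [bg Qg gf]] := IH f' bf'.
    rewrite /f' maxEle.
    have /andP[f0] := f_rng x; rewrite -natr1 mulrDl mul1r => fN.
    have ne0 : 0 <= n%:R * e by rewrite mulr_ge0// ltW.
    by case: (leP (f x - e) 0) => ?; apply/andP; split; lra.
  exists (fun x => e * \1_A x + g x); split.
  - by apply: bmeasD => //; exact/bmeasZ/bmeas_indic.
  - by apply: Qlin => //; [exact: bmeas_indic|exact: Q1].
  - move=> x; have [] := gf x; rewrite /f' maxEle indicE.
    have /andP[f0 _] := f_rng x.
    have -> : (x \in A) = (e <= f x) by apply/idP/idP; rewrite in_setE.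
    by case: (leP (f x - e) 0) => h1; case: (leP e (f x)) => h2 /andP[g0 g1] g2;
      rewrite ?mulr1 ?mulr0; split => //; lra.
move=> f bf; apply: Qlim => // e e0.
have [mf [M fM]] := bf.
pose f1 x := f x + `|M|.
have f1_ge0 x : 0 <= f1 x <= 2 * `|M|.
  have := fM x; rewrite ler_norml => /andP[? ?].
  by have := ler_norm M; rewrite /f1 => ?; apply/andP; split; lra.
have [||g [bg Qg gf]] := step (Num.truncn (2 * `|M| / e)).+1 e f1 e0.
- by apply: bmeasD => //; exact: bmeas_cst.
- move=> x; have /andP[-> h] := f1_ge0 x; apply: (le_trans h).
  by rewrite -ler_pdivrMr//; exact/ltW/truncnS_gt.
exists (fun x => (- `|M|) * \1_setT x + g x); split.
- by apply: bmeasD => //; exact/bmeasZ/bmeas_indic.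
- by apply: Qlin => //; [exact: bmeas_indic|exact: Q1].
- move=> x; have [/andP[h1 h2] h3] := gf x.
  rewrite indicE in_setT mulr1; rewrite /f1 in h1 h2 h3.
  by rewrite ler_norml; apply/andP; split; lra.
Qed.

End BoundedMeasurable.

Section Expectation.
Context {disp : measure_display} {T : measurableType disp} {R : realType}.
Variable m : {measure set T -> \bar R}.
Hypothesis m1 : m setT = 1%E.
Implicit Types f g : T -> R.

(** Serves both [mu] and the laws [P t s]. On [bmeas] functions the integral is finite, so [fine]
    discards nothing. *)
Definition Ex f : R := fine (\int[m]_x (f x)%:E)%E.

Lemma bmeas_integrable f : bmeas f -> m.-integrable setT (EFin \o f).
Proof.
move=> [mf [M fM]]; apply: measurable_bounded_integrable => //.
  by rewrite m1 ltry.
exists M; split; first exact: num_real.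
by move=> N MN x _; exact: le_trans (fM x) (ltW MN).
Qed.

Lemma ExE f : bmeas f -> (\int[m]_x (f x)%:E)%E = (Ex f)%:E.
Proof.
move=> bf; rewrite /Ex fineK//.
exact: integrable_fin_num (bmeas_integrable bf).
Qed.

Lemma Ex_cst a : Ex (fun=> a) = a.
Proof. by rewrite /Ex -/(Rintegral _ _ _) Rintegral_cst// m1 mulr1. Qed.

Lemma ExD f g : bmeas f -> bmeas g -> Ex (fun x => f x + g x) = Ex f + Ex g.
Proof. by move=> bf bg; apply: RintegralD => //; exact: bmeas_integrable. Qed.

Lemma ExB f g : bmeas f -> bmeas g -> Ex (fun x => f x - g x) = Ex f - Ex g.
Proof. by move=> bf bg; apply: RintegralB => //; exact: bmeas_integrable. Qed.

Lemma ExZ a f : bmeas f -> Ex (fun x => a * f x) = a * Ex f.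
Proof. by move=> bf; apply: RintegralZl => //; exact: bmeas_integrable. Qed.

Lemma Ex_sum (I : Type) (r : seq I) (P : pred I) (F : I -> T -> R) :
  (forall i, bmeas (F i)) ->
  Ex (fun x => \sum_(i <- r | P i) F i x) = \sum_(i <- r | P i) Ex (F i).
Proof.
move=> bF; elim: r => [|i r IH].
  by rewrite big_nil; under eq_fun do rewrite big_nil; exact: Ex_cst.
rewrite big_cons -IH; under eq_fun do rewrite big_cons.
by case: (P i) => //; apply: ExD => //; exact: bmeas_sum.
Qed.

Lemma le_Ex f g : bmeas f -> bmeas g -> (forall x, f x <= g x) -> Ex f <= Ex g.
Proof.
by move=> bf bg fg; apply: le_Rintegral => //; exact: bmeas_integrable.
Qed.

Lemma Ex_norm f : bmeas f -> `|Ex f| <= Ex (fun x => `|f x|).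
Proof.
by move=> bf; apply: le_normr_Rintegral => //; exact: bmeas_integrable.
Qed.

Lemma Ex_dist f g : bmeas f -> bmeas g ->
  `|Ex f - Ex g| <= Ex (fun x => `|f x - g x|).
Proof. by move=> bf bg; rewrite -ExB//; exact/Ex_norm/bmeasB. Qed.

Lemma Ex_le_cst f a : bmeas f -> (forall x, f x <= a) -> Ex f <= a.
Proof. by move=> bf fa; rewrite -[leRHS]Ex_cst le_Ex//; exact: bmeas_cst. Qed.

Lemma Ex_ge_cst f a : bmeas f -> (forall x, a <= f x) -> a <= Ex f.
Proof. by move=> bf fa; rewrite -[leLHS]Ex_cst le_Ex//; exact: bmeas_cst. Qed.

Lemma Ex_dist_unif f g e : bmeas f -> bmeas g ->
  (forall x, `|f x - g x| <= e) -> `|Ex f - Ex g| <= e.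
Proof.
move=> bf bg fg; apply: (le_trans (Ex_dist bf bg)).
by apply: Ex_le_cst => //; exact/bmeas_norm/bmeasB.
Qed.

Lemma Ex_dist_tri f g h : bmeas f -> bmeas g -> bmeas h ->
  Ex (fun x => `|f x - h x|) <=
  Ex (fun x => `|f x - g x|) + Ex (fun x => `|g x - h x|).
Proof.
move=> bf bg bh; rewrite -ExD; [|exact/bmeas_norm/bmeasB..].
apply: le_Ex => [||x]; first exact/bmeas_norm/bmeasB.
  by apply: bmeasD; exact/bmeas_norm/bmeasB.
exact: ler_distD.
Qed.

Lemma Ex_indic A : measurable A -> Ex \1_A = fine (m A).
Proof. by move=> mA; rewrite /Ex integral_indic// setIT. Qed.

End Expectation.

(** * Configurations and local functions *)

Section ConfigMeasurable.
Variable d : nat.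
Implicit Types (s : config d) (A : set (config d)) (F : {fset site d}).

Definition coord_sets : set (set (config d)) :=
  [set E | exists j : site d, E = [set s : config d | s j]].

Lemma agree_on_sym F s s' : agree_on F s s' -> agree_on F s' s.
Proof. by move=> h i iF; rewrite h. Qed.

Lemma agree_onS F F' s s' : (F `<=` F')%fset -> agree_on F' s s' -> agree_on F s s'.
Proof. by move=> /fsubsetP FF' h i /FF'; exact: h. Qed.

Lemma open_coord (j : site d) : open [set s : config d | s j].
Proof.
exists [set [set s : config d | s j]]; last by rewrite bigcup_set1.
move=> _ ->; exists [fset [set s : config d | s j]]%fset.
  move=> E; rewrite inE inE => /eqP ->; exists j => //.
  by exists [set true]; [exact: discrete_open|].
by rewrite set_fset1 bigcap_set1.
Qed.

(** The sets of configurations agreeing with [s] on a finite [F] generate a filter along which every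
    coordinate is eventually constant. It converges to [s] in the product topology, hence contains
    [A]. *)
Lemma open_agree A s : open A -> A s ->
  exists F, forall s', agree_on F s s' -> A s'.
Proof.
move=> oA As.
pose G := filter_from [set: {fset site d}] (fun F => [set s' | agree_on F s s']).
have fG : Filter G.
  apply: filter_from_filter; first by exists fset0.
  move=> F F' _ _; exists (F `|` F')%fset => // s' h; split; apply: agree_onS h.
    exact: fsubsetUl.
  exact: fsubsetUr.
have : G --> (s : config d).
  apply/cvg_sup => j; apply/cvg_image => //.
    by apply/seteqP; split => // b _; exists (fun=> b).
  move=> B /= /nbhs_singleton Bs.
  have GB : G [set s' | s' j = s j].
    exists [fset j]%fset => // s' /(_ j) /=; rewrite inE eqxx => h.
    by rewrite h.
  exists ([set s' : config d | B (s' j)]).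
    by apply: filterS GB => s' /= ->.
  apply/seteqP; split => [b [s' Bs' <-]//|b Bb].
  by exists (fun=> b).
move=> /(_ A) /= [|F _ FA]; first exact: open_nbhs_nbhs.
by exists F => s' /FA.
Qed.

(** The Borel field comes from open sets, conditioning from coordinates. They match because an open
    set is a union of cylinders, and there are only countably many cylinders. *)
Lemma measurable_coordE : @measurable _ (config d) = <<s coord_sets>>.
Proof.
apply/seteqP; split.
  apply: smallest_sub; first exact: smallest_sigma_algebra.
  move=> A oA.
  (* The cylinder with spin [true] on [p.1] and [false] on [p.2]; pairs of finite sets of sites are
     countable. *)
  pose B (p : {fset site d} * {fset site d}) : set (config d) :=
    [set s : config d | (forall j, j \in p.1 -> s j) /\ (forall j, j \in p.2 -> ~~ s j)].
  have mj j : measurable ([set s : config d | s j] : set (g_sigma_algebraType coord_sets)).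
    by apply: sub_sigma_algebra; exists j.
  have mB p : measurable (B p : set (g_sigma_algebraType coord_sets)).
    have -> : B p =
      (\bigcap_(j in [set` p.1]) [set s : config d | s j]) `&`
      (\bigcap_(j in [set` p.2]) ~` [set s : config d | s j]).
      apply/seteqP; split => [s [h1 h2]|s [h1 h2]].
        by split=> j jp /=; [exact: h1|exact/negP/h2].
      by split=> j jp; [exact: h1|apply/negP; exact: h2].
    apply: measurableI; apply: fin_bigcap_measurable => // j _.
    exact: (measurableC (mj j)).
  have -> : A = \bigcup_p (if `[< B p `<=` A >] then B p else set0).
    apply/seteqP; split => [s As|s [p _]]; last by case: asboolP => [h /h|_ []].
    have [F FA] := open_agree oA As.
    exists ([fset j in F | s j]%fset, [fset j in F | ~~ s j]%fset) => //.
    case: asboolP => [_|[]].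
      by split=> j; rewrite !inE => /andP[].
    move=> s' [/= h1 h2]; apply: FA => j jF.
    case sj : (s j).
      by rewrite h1// !inE jF sj.
    by apply/esym/negbTE/h2; rewrite !inE jF sj.
  apply: (@countable_bigcupT_measurable _ (g_sigma_algebraType coord_sets)).
    exact: countableP.
  by move=> p; case: asboolP.
apply: smallest_sub; first exact: smallest_sigma_algebra.
move=> _ [j ->]; apply: sub_sigma_algebra; exact: open_coord.
Qed.

Lemma measurable_coord (j : site d) : measurable [set s : config d | s j].
Proof. by apply: sub_sigma_algebra; exact: open_coord. Qed.

End ConfigMeasurable.

Section LocalFunctions.
Variables (R : realType) (d : nat).
Implicit Types (s : config d) (A : set (config d)) (F : {fset site d})
  (f g h : config d -> R).

Definition mix F s s' : config d := fun j => if j \in F then s j else s' j.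

Definition pad F s : config d := mix F s (fun=> false).

Definition cyl F s : set (config d) := [set s' | agree_on F s' s].

Definition pattern F (xi : {ffun F -> bool}) : config d :=
  Defs.glue xi (fun=> false).

Lemma agree_mix F s s' : agree_on F (mix F s s') s.
Proof. by move=> j jF; rewrite /mix jF. Qed.

Lemma pad_agree F s s' : agree_on F s s' -> pad F s = pad F s'.
Proof.
by move=> h; apply/funext => j; rewrite /pad /mix; case: ifP => // /h.
Qed.

Lemma measurable_cyl F s : measurable (cyl F s).
Proof.
have -> : cyl F s = \bigcap_(j in [set` F]) [set s' : config d | s' j = s j].
  by apply/seteqP; split => s' h j /= /h.
apply: fin_bigcap_measurable => // j _; case: (s j); first exact: measurable_coord.
have -> : [set s' : config d | s' j = false] = ~` [set s' : config d | s' j].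
  by apply/seteqP; split => s' /=; [move=> ->|move/negP/negbTE].
by apply: measurableC; exact: measurable_coord.
Qed.

Lemma cyl_pattern F (xi : {ffun F -> bool}) s :
  (s \in cyl F (pattern xi)) = (xi == config_restr F s).
Proof.
apply/idP/eqP => [|->].
  rewrite inE => h; apply/ffunP => j; rewrite ffunE h ?fsvalP//.
  by rewrite /pattern /Defs.glue valK.
rewrite inE => j jF; rewrite /pattern /Defs.glue.
by case: insubP => [j' _ <-|]; [rewrite ffunE|rewrite jF].
Qed.

Lemma local_expansion F f :
  (forall s s', agree_on F s s' -> f s = f s') ->
  f = fun s => \sum_(xi : {ffun F -> bool}) f (pattern xi) * \1_(cyl F (pattern xi)) s.
Proof.
move=> fF; apply/funext => s.
have sE := cyl_pattern (config_restr F s) s; rewrite eqxx in sE.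
rewrite (bigD1 (config_restr F s))//= indicE sE mulr1 big1 ?addr0.
  by apply: fF; exact: set_mem sE.
by move=> xi xis; rewrite indicE cyl_pattern (negbTE xis) mulr0.
Qed.

Lemma local_bmeas f : local_fun f -> bmeas f.
Proof.
move=> [F fF]; rewrite (local_expansion fF); apply: bmeas_sum => xi.
by apply: bmeasZ; apply: bmeas_indic; exact: measurable_cyl.
Qed.

Lemma local_pad F f : local_fun (fun s => f (pad F s)).
Proof. by exists F => s s' /pad_agree ->. Qed.

Lemma local_cst (a : R) : local_fun (fun _ : config d => a).
Proof. by exists fset0. Qed.

Lemma local_lin a f g : local_fun f -> local_fun g ->
  local_fun (fun s => a * f s + g s).
Proof.
move=> [F hf] [G hg]; exists (F `|` G)%fset => s s' h; congr (_ * _ + _).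
  by apply/hf/agree_onS/h/fsubsetUl.
by apply/hg/agree_onS/h/fsubsetUr.
Qed.

Lemma local_sum (I : Type) (r : seq I) (F : I -> config d -> R) :
  (forall i, local_fun (F i)) -> local_fun (fun s => \sum_(i <- r) F i s).
Proof.
move=> hF; elim: r => [|i r IH].
  by under eq_fun do rewrite big_nil; exact: local_cst.
under eq_fun do rewrite big_cons -[F i _]mul1r.
exact: local_lin.
Qed.

(** Uniform approximability by local functions, which on the compact space of configurations is
    continuity. This form supplies the finite window directly. *)
Definition quasilocal f := forall e : R, 0 < e ->
  exists F, forall s s', agree_on F s s' -> `|f s - f s'| <= e.

Lemma quasilocal_bmeas f : quasilocal f -> bmeas f.
Proof.
move=> qf; apply: bmeas_ulim => e /qf[F hF].
exists (fun s => f (pad F s)); first exact/local_bmeas/local_pad.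
by move=> s; apply/hF/agree_on_sym/agree_mix.
Qed.

Lemma local_quasilocal f : local_fun f -> quasilocal f.
Proof.
by move=> [F fF] e e0; exists F => s s' /fF ->; rewrite subrr normr0 ltW.
Qed.

Lemma quasilocalD f g : quasilocal f -> quasilocal g ->
  quasilocal (fun s => f s + g s).
Proof.
move=> hf hg e e0.
have e20 : 0 < e / 2 by rewrite divr_gt0.
have [F fF] := hf _ e20; have [G gG] := hg _ e20.
exists (F `|` G)%fset => s s' h; rewrite opprD addrACA (splitr e).
apply: (le_trans (ler_normD _ _)); apply: lerD.
  by apply/fF/agree_onS/h/fsubsetUl.
by apply/gG/agree_onS/h/fsubsetUr.
Qed.

Lemma quasilocal_cst (a : R) : quasilocal (fun=> a).
Proof. exact/local_quasilocal/local_cst. Qed.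

Lemma quasilocalM f g : quasilocal f -> quasilocal g ->
  quasilocal (fun s => f s * g s).
Proof.
move=> hf hg e e0.
have [_ [M fM]] := quasilocal_bmeas hf; have [_ [N gN]] := quasilocal_bmeas hg.
pose K := `|M| + `|N| + 1.
have K0 : 0 < K by rewrite ltr_wpDl// addr_ge0.
have e20 : 0 < e / (K * 2) by rewrite divr_gt0// mulr_gt0.
have [F fF] := hf _ e20; have [G gG] := hg _ e20.
exists (F `|` G)%fset => s s' h.
have -> : f s * g s - f s' * g s' = f s * (g s - g s') + (f s - f s') * g s'.
  by ring.
have eE : e = K * (e / (K * 2)) + (e / (K * 2)) * K by field; rewrite gt_eqF.
rewrite [leRHS]eE; apply: (le_trans (ler_normD _ _)); rewrite !normrM.
have MK : M <= K.
  by rewrite (le_trans (ler_norm _))// /K -addrA lerDl addr_ge0.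
have NK : N <= K.
  by rewrite (le_trans (ler_norm _))// /K addrAC lerDr addr_ge0.
apply: lerD; apply: ler_pM => //.
- exact: le_trans (fM _) MK.
- by apply/gG/agree_onS/h/fsubsetUr.
- by apply/fF/agree_onS/h/fsubsetUl.
- exact: le_trans (gN _) NK.
Qed.

Lemma quasilocalZ (a : R) f : quasilocal f -> quasilocal (fun s => a * f s).
Proof. exact/quasilocalM/quasilocal_cst. Qed.

Lemma quasilocalB f g : quasilocal f -> quasilocal g ->
  quasilocal (fun s => f s - g s).
Proof.
move=> hf hg; have := quasilocalD hf (quasilocalZ (-1) hg).
by under eq_fun do rewrite mulN1r.
Qed.

Lemma quasilocal_sum (I : Type) (r : seq I) (F : I -> config d -> R) :
  (forall i, quasilocal (F i)) -> quasilocal (fun s => \sum_(i <- r) F i s).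
Proof.
move=> hF; elim: r => [|i r IH].
  by under eq_fun do rewrite big_nil; exact: quasilocal_cst.
by under eq_fun do rewrite big_cons; exact: quasilocalD.
Qed.

(** Agreement is symmetric, so the single implication says that the spins in [F] decide membership.
    These sets form a generating pi-system for Dynkin induction. *)
Definition local_sets : set (set (config d)) :=
  [set A | exists F, forall s s', agree_on F s s' -> A s -> A s'].

Lemma local_sets_indic A : local_sets A -> local_fun (\1_A : config d -> R).
Proof.
move=> [F AF]; exists F => s s' h; rewrite !indicE; congr (_ %:R); congr nat_of_bool.
by apply/idP/idP; rewrite !inE; [exact: AF h|exact/AF/agree_on_sym].
Qed.

Lemma local_sets_measurable A : local_sets A -> measurable A.
Proof.
by move=> /local_sets_indic/local_bmeas[mA _]; apply/(measurable_indicP R).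
Qed.

Lemma measurable_local_setsE : @measurable _ (config d) = <<s local_sets>>.
Proof.
apply/seteqP; split.
  rewrite measurable_coordE; apply: smallest_sub; first exact: smallest_sigma_algebra.
  move=> _ [j ->]; apply: sub_sigma_algebra; exists [fset j]%fset => s s' h /= sj.
  by rewrite -h// inE.
apply: smallest_sub; last exact: local_sets_measurable.
exact: sigma_algebra_measurable.
Qed.

Lemma local_setsI : setI_closed local_sets.
Proof.
move=> A B [F AF] [G BG]; exists (F `|` G)%fset => s s' h [As Bs]; split.
  by apply: AF As; apply/agree_onS/h/fsubsetUl.
by apply: BG Bs; apply/agree_onS/h/fsubsetUr.
Qed.

End LocalFunctions.

(** * Density of the local functions in $L^1$ *)

Section Density.
Variables (R : realType) (d : nat) (m : {measure set (config d) -> \bar R}).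
Hypothesis m1 : m setT = 1%E.

Let m_le1 (A : set (config d)) : measurable A -> (m A <= 1)%E.
Proof. by move=> mA; rewrite -m1 le_measure// inE. Qed.

(** Dynkin induction: complements are handled by [1 - h], and countable additivity reduces a
    disjoint union to finitely many of its members. *)
Lemma local_dense_indic (A : set (config d)) : measurable A ->
  forall e : R, 0 < e -> exists2 h : config d -> R, local_fun h &
    Ex m (fun s => `|\1_A s - h s|) <= e.
Proof.
rewrite (measurable_local_setsE R).
move: A; apply: (dynkin_induction (measurable_local_setsE R d)).
- exact: local_setsI.
- move=> e e0; exists (fun=> 1); first exact: local_cst.
  rewrite (_ : (fun s => _) = fun=> 0) ?Ex_cst ?ltW//.
  by apply/funext => s; rewrite indicE in_setT subrr normr0.
- move=> A lA e e0; exists \1_A; first exact: local_sets_indic.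
  rewrite (_ : (fun s => _) = fun=> 0) ?Ex_cst ?ltW//.
  by apply/funext => s; rewrite subrr normr0.
- move=> A mA IH e /IH[h lh Ah].
  exists (fun s => -1 * h s + 1); first exact/local_lin/local_cst.
  rewrite (_ : (fun s => _) = fun s => `|\1_A s - h s|)//.
  apply/funext => s; rewrite !indicE in_setC -normrN; congr `|_|.
  by case: (s \in A) => /=; ring.
- move=> F mF tF IH e e0.
  have e20 : 0 < e / 2 by rewrite divr_gt0.
  have mUF : measurable (\bigcup_k F k) by exact: bigcup_measurable.
  pose S n (s : config d) : R := \sum_(i < n) \1_(F i) s.
  have bS n : bmeas (S n) by apply: bmeas_sum => i; exact: bmeas_indic.
  have SUF n s : S n s <= \1_(\bigcup_k F k) s.
    rewrite -lee_fin indic_bigcup// /S -sumEFin -(big_mkord xpredT (fun i => (\1_(F i) s)%:E)).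
    by apply: nneseries_lim_ge => i _ _; rewrite lee_fin.
  have [n hn] : exists n, Ex m (fun s => `|\1_(\bigcup_k F k) s - S n s|) <= e / 2.
    have cvgF := @measure_semi_sigma_additive _ _ _ m F mF tF mUF.
    have mUfin : m (\bigcup_k F k) \is a fin_num.
      by rewrite ge0_fin_numE// (le_lt_trans (m_le1 mUF))// ltry.
    have : \forall n \near \oo,
        (m (\bigcup_k F k) - (e / 2)%:E < \sum_(0 <= i < n) m (F i))%E.
      have lt : (m (\bigcup_k F k) - (e / 2)%:E < m (\bigcup_k F k))%E.
        by rewrite -(fineK mUfin) -EFinB lte_fin ltrBlDr ltrDl.
      exact: (cvgF _ (open_ereal_gt' lt)).
    move=> [n _ /(_ n (leqnn n)) /= hn]; exists n.
    rewrite (_ : (fun s => _) = fun s => \1_(\bigcup_k F k) s - S n s); last first.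
      by apply/funext => s; rewrite ger0_norm// subr_ge0.
    rewrite ExB//; last exact: bmeas_indic.
    rewrite lerBlDr -lerBlDl -lee_fin.
    rewrite Ex_indic// Ex_sum//; last by move=> i; exact: bmeas_indic.
    rewrite EFinB fineK// (le_trans (ltW hn))// big_mkord -sumEFin.
    apply: lee_sum => i _; rewrite Ex_indic// fineK//.
    by rewrite ge0_fin_numE// (le_lt_trans (m_le1 (mF i)))// ltry.
  (* At most [n] such errors are added; dividing by [n.+1] also covers [n = 0]. *)
  have /choice[h hh] : forall k, exists h : config d -> R, local_fun h /\
      Ex m (fun s => `|\1_(F k) s - h s|) <= e / 2 / n.+1%:R.
    move=> k; have [|h ? ?] := IH k (e / 2 / n.+1%:R); first by rewrite divr_gt0.
    by exists h.
  have bh k : bmeas (h k) by apply/local_bmeas; exact: (hh k).1.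
  exists (fun s => \sum_(i < n) h i s); first by apply: local_sum => i; exact: (hh i).1.
  have bSh : bmeas (fun s => \sum_(i < n) h i s) by apply: bmeas_sum.
  rewrite (splitr e).
  apply: (le_trans (Ex_dist_tri m1 (bmeas_indic mUF) (bS n) bSh)).
  apply: lerD => //.
  have bD k : bmeas (fun s => `|\1_(F k) s - h k s|).
    by apply/bmeas_norm/bmeasB => //; exact: bmeas_indic.
  apply: (@le_trans _ _ (Ex m (fun s => \sum_(i < n) `|\1_(F i) s - h i s|))).
    apply: le_Ex => // [||s].
    - exact/bmeas_norm/bmeasB.
    - exact: bmeas_sum.
    - by rewrite /S -sumrB; exact: ler_norm_sum.
  rewrite Ex_sum//.
  apply: (@le_trans _ _ (\sum_(i < n) (e / 2 / n.+1%:R))).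
    by apply: ler_sum => i _; exact: (hh i).2.
  rewrite sumr_const card_ord -[leLHS]mulr_natr mulrAC ler_pdivrMr//.
  by rewrite ler_wpM2l ?ler_nat// ltW.
Qed.

Lemma local_dense f : bmeas f -> forall e : R, 0 < e ->
  exists2 h : config d -> R, local_fun h & Ex m (fun s => `|f s - h s|) <= e.
Proof.
move: f; apply: bmeas_ind.
- exact: local_dense_indic.
- move=> a f g bf bg IHf IHg e e0.
  have e20 : 0 < e / 2 by rewrite divr_gt0.
  have a0 : 0 < `|a| + 1 by rewrite ltr_wpDl.
  have [hf lf ef] := IHf _ (divr_gt0 e20 a0).
  have [hg lg eg] := IHg _ e20.
  have bhf := local_bmeas lf; have bhg := local_bmeas lg.
  exists (fun s => a * hf s + hg s); first exact: local_lin.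
  apply: (@le_trans _ _ (Ex m (fun s => `|a| * `|f s - hf s| + `|g s - hg s|))).
    apply: le_Ex => // [||s].
    - apply/bmeas_norm/bmeasB; apply: bmeasD => //; exact: bmeasZ.
    - by apply: bmeasD; [apply: bmeasZ|]; apply/bmeas_norm/bmeasB.
    - rewrite -normrM (_ : _ - _ = a * (f s - hf s) + (g s - hg s)); last by ring.
      exact: ler_normD.
  rewrite ExD//; [|by apply: bmeasZ; apply/bmeas_norm/bmeasB|by apply/bmeas_norm/bmeasB].
  rewrite ExZ//; last by apply/bmeas_norm/bmeasB.
  rewrite (splitr e) lerD//.
  apply: (@le_trans _ _ ((`|a| + 1) * (e / 2 / (`|a| + 1)))).
    apply: ler_pM => //; last by rewrite lerDl.
    by apply: Ex_ge_cst => //; apply/bmeas_norm/bmeasB.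
  by rewrite mulrC divfK// gt_eqF.
- move=> f bf IH e e0.
  have e20 : 0 < e / 2 by rewrite divr_gt0.
  have [g [bg Qg fg]] := IH _ e20.
  have [h lh gh] := Qg _ e20; have bh := local_bmeas lh.
  exists h => //; rewrite (splitr e).
  apply: (le_trans (Ex_dist_tri m1 bf bg bh)); apply: lerD => //.
  by apply: Ex_le_cst => //; apply/bmeas_norm/bmeasB.
Qed.

End Density.

(** * Single-site conditional probabilities *)

Section RSum.
Variables (R : realType) (T : choiceType) (D : set T).
Implicit Types a b : T -> R.

Lemma esum_pos_lip a b (e : R) :
  summable D (EFin \o a) -> summable D (EFin \o b) ->
  (\esum_(t in D) `|a t - b t|%R%:E <= e%:E)%E ->
  fine (\esum_(t in D) (EFin \o a)^\+ t)%E <=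
    fine (\esum_(t in D) (EFin \o b)^\+ t)%E + e.
Proof.
move=> sa sb ab.
have fin (c : T -> R) : summable D (EFin \o c) -> (\esum_(t in D) (EFin \o c)^\+ t)%E \is a fin_num.
  move=> /summable_funepos; rewrite summableE.
  by under eq_esum do rewrite gee0_abs//.
rewrite -lee_fin EFinD !fineK; [|exact: fin..].
apply: (@le_trans _ _ (\esum_(t in D) (EFin \o b)^\+ t +
    \esum_(t in D) `|a t - b t|%R%:E)%E); last exact: leeD2l.
rewrite -esumD//; apply: le_esum => t _.
rewrite !funeposE /= -!EFin_max -EFinD lee_fin.
have := ler_norm (a t - b t); have := normr_ge0 (a t - b t).
by rewrite !maxEle; case: (leP (a t) 0); case: (leP (b t) 0) => *; lra.
Qed.

(** [rsum] is a difference of two sums, over positive and over negative parts, and each is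
    1-Lipschitz; hence the factor 2. *)
Lemma rsum_lip a b (e : R) :
  summable D (EFin \o a) -> summable D (EFin \o b) ->
  (\esum_(t in D) `|a t - b t|%R%:E <= e%:E)%E ->
  `|rsum D a - rsum D b| <= 2 * e.
Proof.
move=> sa sb ab.
have negE (c : T -> R) : ((EFin \o c)^\- = (EFin \o (fun t => - c t)%R)^\+)%E.
  by apply/funext => t; rewrite funenegE funeposE.
have sN (c : T -> R) : summable D (EFin \o c) -> summable D (EFin \o (fun t => - c t)).
  by apply: le_lt_trans; apply: le_esum => t _ /=; rewrite normrN.
have fin (c : T -> R) : summable D (EFin \o c) -> (\esum_(t in D) (EFin \o c)^\+ t)%E \is a fin_num.
  move=> /summable_funepos; rewrite summableE.
  by under eq_esum do rewrite gee0_abs//.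
have rE (c : T -> R) : summable D (EFin \o c) -> rsum D c =
    fine (\esum_(t in D) (EFin \o c)^\+ t)%E
    - fine (\esum_(t in D) (EFin \o (fun t => - c t)%R)^\+ t)%E.
  by move=> sc; rewrite /rsum negE fineB//; apply: fin => //; exact: sN.
have h1 := esum_pos_lip sa sb ab.
have ba : (\esum_(t in D) `|b t - a t|%R%:E <= e%:E)%E.
  by under eq_esum do rewrite distrC.
have h2 := esum_pos_lip sb sa ba.
have h3 : fine (\esum_(t in D) (EFin \o (fun t => - a t)%R)^\+ t)%E <=
    fine (\esum_(t in D) (EFin \o (fun t => - b t)%R)^\+ t)%E + e.
  apply: esum_pos_lip; [exact: sN..|].
  by under eq_esum do rewrite opprK addrC.
have h4 : fine (\esum_(t in D) (EFin \o (fun t => - b t)%R)^\+ t)%E <=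
    fine (\esum_(t in D) (EFin \o (fun t => - a t)%R)^\+ t)%E + e.
  apply: esum_pos_lip; [exact: sN..|].
  by under eq_esum do rewrite opprK addrC.
by rewrite !rE// ler_norml; apply/andP; split; lra.
Qed.

Lemma esum_tail (c : T -> \bar R) : (forall t, D t -> (0 <= c t)%E) ->
  (\esum_(t in D) c t < +oo)%E -> forall e : R, 0 < e ->
  exists2 X : {fset T}, [set` X] `<=` D &
    (\esum_(t in D `\` [set` X]) c t <= e%:E)%E.
Proof.
move=> c0 coo e e0.
have cfin : (\esum_(t in D) c t)%E \is a fin_num.
  by rewrite ge0_fin_numE// esum_ge0.
have : (\esum_(t in D) c t - e%:E < \esum_(t in D) c t)%E.
  by rewrite -(fineK cfin) -EFinB lte_fin ltrBlDr ltrDl.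
move=> /ereal_sup_gt[_ [X [finX XD] <-]] hX.
exists (fset_set X); rewrite fset_setK//.
have c0X t : X t -> (0 <= c t)%E by move=> /XD; exact: c0.
move: hX; rewrite -(esum_fset finX); last by move=> t /set_mem /c0X.
move=> hX.
have := esumID X D c c0; rewrite setIidr// => E.
have Xfin : (\esum_(t in X) c t)%E \is a fin_num.
  rewrite ge0_fin_numE ?esum_ge0// (le_lt_trans _ coo)// E leeDl// esum_ge0// => t [].
  by move=> /c0.
have rest0 : (0 <= \esum_(t in D `\` X) c t)%E.
  by apply: esum_ge0 => t [/c0].
have restfin : (\esum_(t in D `\` X) c t)%E \is a fin_num.
  by rewrite ge0_fin_numE// (le_lt_trans _ coo)// E -setDE leeDr// esum_ge0.
move: hX; rewrite E -setDE -(fineK Xfin) -(fineK restfin).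
by rewrite -!EFinD lte_fin lee_fin => ?; lra.
Qed.

End RSum.

Section SiteConditionals.
Variables (R : realType) (d : nat) (U : {fset site d} -> config d -> R).
Implicit Types (i j x : site d) (s : config d) (v : bool) (A : {fset site d}).

Definition set_spin i v s : config d := fun j => if j == i then v else s j.

Lemma glue_single i v s :
  Defs.glue [ffun _ : [fset i]%fset => v] s = set_spin i v s.
Proof.
apply/funext => j; rewrite /Defs.glue /set_spin; case: insubP => [k|].
  by rewrite inE => /eqP -> _; rewrite eqxx ffunE.
by rewrite inE => /negbTE ->.
Qed.

Lemma sum_ffun_single i (F : {ffun [fset i]%fset -> bool} -> R) :
  \sum_xi F xi = F [ffun=> true] + F [ffun=> false].
Proof.
rewrite (reindex (fun b : bool => [ffun _ : [fset i]%fset => b])) /=.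
  by rewrite big_bool.
exists (fun xi : {ffun [fset i]%fset -> bool} => xi [` fset11 i]%fset) => b _.
  by rewrite ffunE.
apply/ffunP => k; rewrite ffunE; congr (b _); apply: val_inj => /=.
by have := fsvalP k; rewrite inE => /eqP ->.
Qed.

Definition energy i v s : R :=
  rsum [set A : {fset site d} | i \in A] (fun A => U A (set_spin i v s)).

Lemma hamiltonian_single i v s :
  hamiltonian U s [ffun _ : [fset i]%fset => v] = energy i v s.
Proof.
rewrite /hamiltonian /energy.
have -> : [set A : {fset site d} | (A `&` [fset i])%fset != fset0] =
    [set A : {fset site d} | i \in A].
  apply/seteqP; split => A /=.
    by case/fset0Pn => j; rewrite !inE => /andP[jA /eqP <-].
  by move=> iA; apply/fset0Pn; exists i; rewrite !inE iA eqxx.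
by congr rsum; apply/funext => A; rewrite glue_single.
Qed.

Lemma site_condE i v s : site_cond U i v s = expR (- energy i v s) /
  (expR (- energy i true s) + expR (- energy i false s)).
Proof.
by rewrite /site_cond /gibbs_weight sum_ffun_single !hamiltonian_single.
Qed.

Lemma site_cond_ge0 i v s : 0 <= site_cond U i v s.
Proof. by rewrite site_condE divr_ge0 ?addr_ge0 ?expR_ge0. Qed.

Lemma site_cond_sum i s : site_cond U i true s + site_cond U i false s = 1.
Proof.
by rewrite !site_condE -mulrDl divff// gt_eqF// addr_gt0 ?expR_gt0.
Qed.

(** Only the energy difference matters, so continuity of the conditional probability reduces to that
    of two energies, the logistic function being Lipschitz. *)
Lemma site_cond_logistic i s :
  site_cond U i true s = (1 + expR (energy i true s - energy i false s))^-1.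
Proof.
rewrite site_condE expRD expRN.
have := expR_gt0 (energy i true s); have := expR_gt0 (- energy i false s).
move: (expR _) (expR _) => a b a0 b0; field.
by rewrite !gt_eqF// addr_gt0// mulr_gt0.
Qed.

Lemma set_spin_flip i v s : set_spin i v (flip i s) = set_spin i v s.
Proof.
by apply/funext => j; rewrite /set_spin /flip; case: eqVneq => // /negbTE ->.
Qed.

Lemma site_cond_flip i v s : site_cond U i v (flip i s) = site_cond U i v s.
Proof. by rewrite !site_condE /energy !set_spin_flip. Qed.

Hypothesis HU : translation_invariant_interaction U.

Lemma set_spin_translate i v x s :
  set_spin (i + x) v (translate x s) = translate x (set_spin i v s).
Proof.
by apply/funext => j; rewrite /set_spin /translate subr_eq.
Qed.

Lemma mem_shift i x A :
  (i + x \in [fset (y + x)%R | y in A]%fset) = (i \in A).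
Proof.
by apply/imfsetP/idP => [[j jA /addIr ->]//|iA]; exists i.
Qed.

Lemma shift_bij i x : set_bij [set A : {fset site d} | i \in A]
  [set A : {fset site d} | i + x \in A]
  (fun A => [fset (y + x)%R | y in A]%fset).
Proof.
split.
- by move=> A /= iA; rewrite mem_shift.
- move=> A B _ _ /fsetP AB; apply/fsetP => y.
  by have := AB (y + x); rewrite !mem_shift.
- move=> A /= iA; exists [fset (y - x)%R | y in A]%fset => /=.
    by have := mem_shift (i + x) (- x) A; rewrite addrK => ->.
  apply/fsetP => y; rewrite -[y in LHS](subrK x) mem_shift.
  exact: mem_shift.
Qed.

Lemma energy_translate i v x s :
  energy (i + x) v (translate x s) = energy i v s.
Proof.
have [_ UT _] := HU.
rewrite /energy /rsum !(reindex_esum _ _ _ _ (shift_bij i x)); congr fine.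
by congr (_ - _)%E; apply: eq_esum => A _; rewrite ?funeposE ?funenegE /=
  set_spin_translate UT.
Qed.

Lemma site_cond_translate i v x s :
  site_cond U (i + x) v (translate x s) = site_cond U i v s.
Proof. by rewrite !site_condE !energy_translate. Qed.

Lemma translateK x s : translate (- x) (translate x s) = s.
Proof. by apply/funext => j; rewrite /translate opprK addrK. Qed.

(** The interaction is assumed summable at the origin; translation brings every site there. *)
Lemma site_cond_origin i v s :
  site_cond U i v s = site_cond U 0 v (translate (- i) s).
Proof. by rewrite -(site_cond_translate i v (- i)) subrr. Qed.

End SiteConditionals.

Section SiteConditionalRegularity.
Variables (R : realType) (d : nat) (U : {fset site d} -> config d -> R).
Implicit Types (i j x : site d) (s : config d) (v : bool) (A : {fset site d}).
Hypothesis HU : translation_invariant_interaction U.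

Let supU A : \bar R := ereal_sup [set `|U A s|%:E | s in [set: config d]].

Let le_supU A s : (`|U A s|%:E <= supU A)%E.
Proof. by apply: ereal_sup_ubound; exists s. Qed.

Let supU_ge0 A : (0 <= supU A)%E.
Proof. by apply: le_trans (le_supU A (fun=> false)); rewrite lee_fin. Qed.

Lemma energy_quasilocal v : quasilocal (energy U 0 v).
Proof.
have [Uloc _ Usum] := HU => e e0.
(* The tail of the interaction counts twice, for [s] and for [s'], and [rsum_lip] doubles the result
   once more. *)
have e40 : 0 < e / 4 by rewrite divr_gt0.
have [X XD tailX] := esum_tail (fun A _ => supU_ge0 A) Usum e40.
have summ s : summable [set A : {fset site d} | 0 \in A]
    (EFin \o (fun A => U A (set_spin 0 v s))).
  by apply: le_lt_trans Usum; apply: le_esum => A _; exact: le_supU.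
exists (\bigcup_(A <- enum_fset X) A)%fset => s s' h.
have agreeX A : A \in X -> U A (set_spin 0 v s) = U A (set_spin 0 v s').
  move=> AX; apply: Uloc => j jA; rewrite /set_spin; case: ifP => // _.
  by apply: h; apply/bigfcupP; exists A; rewrite ?andbT.
have -> : e = 2 * (e / 2) by field.
apply: rsum_lip => //.
rewrite (esumID [set` X])//.
rewrite [X in (X + _)%E]esum1; last first.
  by move=> A [_ /= AX]; rewrite agreeX// subrr normr0.
rewrite add0e.
apply: (@le_trans _ _ (\esum_(A in [set A : {fset site d} | 0%R \in A] `\` [set` X])
    (supU A + supU A))%E).
  apply: le_esum => A _; apply: (@le_trans _ _ (`|U A (set_spin 0 v s)|%:E
      + `|U A (set_spin 0 v s')|%:E)%E); last by apply: leeD; exact: le_supU.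
  by rewrite -EFinD lee_fin ler_normB.
rewrite esumD; [|by move=> A _; exact: supU_ge0..].
have -> : e / 2 = e / 4 + e / 4 by field.
by rewrite EFinD leeD.
Qed.

Lemma logistic_lip (a b : R) :
  `|(1 + expR a)^-1 - (1 + expR b)^-1| <= `|a - b|.
Proof.
wlog ab : a b / a <= b.
  by move=> H; case: (leP a b) => [/H//|/ltW /H]; rewrite distrC [X in _ <= X]distrC.
have ea := expR_gt0 a; have eb := expR_gt0 b.
have -> : (1 + expR a)^-1 - (1 + expR b)^-1 =
    (expR b - expR a) / ((1 + expR a) * (1 + expR b)).
  by field; rewrite !gt_eqF ?addr_gt0.
rewrite [X in _ <= X]ler0_norm ?subr_le0// opprB ger0_norm; last first.
  by apply: divr_ge0; [rewrite subr_ge0 ler_expR|rewrite mulr_ge0// addr_ge0// ltW].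
rewrite ler_pdivrMr ?mulr_gt0 ?addr_gt0//.
(* The tangent inequality bounds the numerator by $(b - a)e^b$, and $e^b$ is at most the
   denominator. *)
have h : expR b - expR a <= (b - a) * expR b.
  have := expR_ge1Dx (a - b); rewrite expRD expRN -(ler_pM2r eb).
  by rewrite divfK ?gt_eqF// => ?; lra.
apply: (le_trans h); rewrite ler_wpM2l ?subr_ge0//.
by nra.
Qed.

Lemma site_cond_quasilocal i : quasilocal (site_cond U i true).
Proof.
move=> e e0.
have e20 : 0 < e / 2 by rewrite divr_gt0.
have [F hF] := energy_quasilocal true e20.
have [G hG] := energy_quasilocal false e20.
exists [fset (y + i)%R | y in (F `|` G)%fset]%fset => s s' h.
rewrite !(site_cond_origin HU i) !site_cond_logistic.
apply: (le_trans (logistic_lip _ _)).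
have h' : agree_on (F `|` G)%fset (translate (- i) s) (translate (- i) s').
  by move=> j jFG; rewrite /translate opprK; apply: h; rewrite mem_shift.
have /hF : agree_on F (translate (- i) s) (translate (- i) s').
  by apply/agree_onS/h'/fsubsetUl.
have /hG : agree_on G (translate (- i) s) (translate (- i) s').
  by apply/agree_onS/h'/fsubsetUr.
by rewrite !ler_norml => /andP[? ?] /andP[? ?]; apply/andP; split; lra.
Qed.

Definition dobrushin i j : R := fine (dobrushin_matrix U i j).

Lemma site_cond_le1 i v s : site_cond U i v s <= 1.
Proof.
by rewrite -(site_cond_sum U i s); case: v; rewrite ?lerDl ?lerDr site_cond_ge0.
Qed.

Lemma dobrushinE i j : dobrushin_matrix U i j = (dobrushin i j)%:E.
Proof.
rewrite /dobrushin fineK// fin_numElt; apply/andP; split.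
  apply: (@lt_le_trans _ _ 0%E) => //.
  apply: (@le_trans _ _ `|site_cond U i true (flip j (fun=> false))
      - site_cond U i true (fun=> false)|%:E); first by rewrite lee_fin.
  by apply: ereal_sup_ubound; exists (true, fun=> false).
apply: (@le_lt_trans _ _ 1%E); last by rewrite ltry.
apply: ge_ereal_sup => _ [[v s] _ <-]; rewrite lee_fin /=.
have := site_cond_ge0 U i v s; have := site_cond_le1 i v s.
have := site_cond_ge0 U i v (flip j s); have := site_cond_le1 i v (flip j s).
by rewrite ler_norml => *; apply/andP; split; lra.
Qed.

Lemma site_cond_dobrushin i j v s :
  `|site_cond U i v (flip j s) - site_cond U i v s| <= dobrushin i j.
Proof.
rewrite -lee_fin -dobrushinE; apply: ereal_sup_ubound.
by exists (v, s).
Qed.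

Lemma dobrushin_ge0 i j : 0 <= dobrushin i j.
Proof. exact: le_trans (site_cond_dobrushin i j true (fun=> false)). Qed.

Lemma flip_translate j x s : flip (j + x) (translate x s) = translate x (flip j s).
Proof. by apply/funext => k; rewrite /flip /translate subr_eq addrK. Qed.

Lemma dobrushin_translate i j x : dobrushin (i + x) (j + x) = dobrushin i j.
Proof.
suff le k l y : dobrushin (k + y) (l + y) <= dobrushin k l.
  by apply/le_anti; rewrite le//= -{1}(addrK x i) -{1}(addrK x j) le.
rewrite -lee_fin -!dobrushinE; apply: ge_ereal_sup => _ [[v s] _ <-].
rewrite dobrushinE lee_fin /=.
rewrite -(translateK (- y) s) opprK flip_translate !site_cond_translate//.
exact: site_cond_dobrushin.
Qed.

Hypothesis HD : dobrushin_condition U.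

(* [dobrushin i j] depends on [j - i] only, so column sums are row sums. *)
Lemma dobrushin_sums : exists2 q : R, 0 <= q < 1 & forall F : {fset site d},
  (forall i, \sum_(j <- F) dobrushin i j <= q) /\
  (forall j, \sum_(i <- F) dobrushin i j <= q).
Proof.
pose Q := ereal_sup [set \esum_(j in [set: site d]) dobrushin_matrix U i j
             | i in [set: site d]].
have rowQ i : (\esum_(j in [set: site d]) dobrushin_matrix U i j <= Q)%E.
  by apply: ereal_sup_ubound; exists i.
have Q0 : (0 <= Q)%E.
  apply: le_trans (rowQ 0); apply: esum_ge0 => j _.
  by rewrite dobrushinE lee_fin dobrushin_ge0.
have Q1 : (Q < 1)%E := HD.
have Qfin : Q \is a fin_num by rewrite ge0_fin_numE// (lt_trans Q1)// ltry.
have row (F : {fset site d}) i : \sum_(j <- F) dobrushin i j <= fine Q.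
  rewrite -lee_fin fineK// (le_trans _ (rowQ i))//; apply: esum_ge.
  exists [set` F] => //; rewrite fsbig_finite//= set_fsetK -sumEFin.
  by apply: lee_sum => j _; rewrite dobrushinE.
exists (fine Q); first by rewrite fine_ge0//= -lte_fin fineK.
move=> F; split=> [|j]; first exact: row.
rewrite (eq_bigr (fun i => dobrushin 0 (j - i))); last first.
  by move=> i _; rewrite -(dobrushin_translate i j (- i)) subrr.
rewrite (_ : \sum_(i <- F) _ = \sum_(k <- [fset (j - i)%R | i in F]%fset) dobrushin 0 k).
  exact: row.
by rewrite big_imfset//= => a b _ _ /addrI/oppr_inj.
Qed.

End SiteConditionalRegularity.

(** * The discrete-time heat bath *)

Section SetSpin.
Variable d : nat.
Implicit Types (i j : site d) (s : config d) (v : bool).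

(** [set_spin i v s] does not see the spin of [s] at [i]. This makes its preimages admissible
    conditioning events in the DLR equation at [i]. *)
Lemma set_spin_outside i v (A : set (config d)) : measurable A ->
  outside [fset i]%fset (set_spin i v @^-1` A).
Proof.
rewrite measurable_coordE.
suff : <<s @coord_sets d>> `<=` [set B | outside [fset i]%fset (set_spin i v @^-1` B)].
  exact.
apply: smallest_sub.
  split => [|B oB|B oB] /=; first exact: sigma_algebra0.
    by rewrite setTD; exact: sigma_algebraC.
  by rewrite preimage_bigcup; exact: sigma_algebra_bigcup.
move=> _ [j ->] /=.
have [->|ji] := eqVneq j i.
  have -> : set_spin i v @^-1` [set s | s i] = if v then setT else set0.
    by apply/seteqP; case: v; split => s //=; rewrite /set_spin eqxx.
  by case: v; [rewrite -setC0; apply: sigma_algebraC; exact: sigma_algebra0|exact: sigma_algebra0].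
apply: sub_sigma_algebra; exists j; first by rewrite inE.
by apply/seteqP; split => s /=; rewrite /set_spin (negbTE ji).
Qed.

Lemma outside_measurable (F : {fset site d}) A : outside F A -> measurable A.
Proof.
apply: smallest_sub; first exact: sigma_algebra_measurable.
by move=> _ [j _ ->]; exact: measurable_coord.
Qed.

Lemma measurable_set_spin i v :
  measurable_fun [set: config d] (set_spin i v : config d -> config d).
Proof.
move=> _ A mA; rewrite setTI.
apply: (@outside_measurable [fset i]%fset); exact: set_spin_outside.
Qed.

Lemma set_spinE i v s : set_spin i v s = if v == s i then s else flip i s.
Proof.
apply/funext => j; rewrite /set_spin /flip.
case: (eqVneq j i) => [->|ji]; case: eqVneq => //=.
  by rewrite eqxx; case: v; case: (s i).
by rewrite (negbTE ji).
Qed.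

Lemma set_spin_flipC i j v s : j != i ->
  set_spin i v (flip j s) = flip j (set_spin i v s).
Proof.
move=> ji; apply/funext => k; rewrite /set_spin /flip (negbTE ji).
by case: (eqVneq k i) => // ->; rewrite eq_sym (negbTE ji).
Qed.

Lemma set_spin_set i v w s : set_spin i v (set_spin i w s) = set_spin i v s.
Proof. by apply/funext => k; rewrite /set_spin; case: (k == i). Qed.

Lemma flip_set_spin i v s : flip i (set_spin i v s) = set_spin i (~~ v) s.
Proof.
by apply/funext => k; rewrite /set_spin /flip eqxx; case: (k == i).
Qed.

End SetSpin.

Section DiscreteHeatBath.
Variables (R : realType) (d : nat) (p : site d -> config d -> R)
  (C : site d -> site d -> R) (q : R).
Implicit Types (i j : site d) (s : config d) (F : {fset site d})
  (f g h : config d -> R) (u w : site d -> R).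

Definition resample i f : config d -> R :=
  fun s => p i s * f (set_spin i true s) + (1 - p i s) * f (set_spin i false s).

Definition step F (e : R) f : config d -> R :=
  fun s => f s + e * \sum_(i <- F) (resample i f s - f s).

(** Oscillations are carried as upper bounds [u] rather than as suprema, so that they evolve
    linearly under [vstep]. *)
Definition osc_le f u := forall i s, `|f (flip i s) - f s| <= u i.

(* The coordinatewise oscillation bound after one step; column [j] loses a
   fraction [e] of itself when [j] is resampled. *)
Definition vstep F (e : R) u : site d -> R :=
  fun j => u j + e * \sum_(i <- F) (C i j * u i - (i == j)%:R * u j).

Hypothesis p01 : forall i s, 0 <= p i s <= 1.
Hypothesis pflip : forall i s, p i (flip i s) = p i s.
Hypothesis pql : forall i, quasilocal (p i).
Hypothesis pC : forall i j s, `|p i (flip j s) - p i s| <= C i j.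

Lemma C_ge0 i j : 0 <= C i j.
Proof. exact: le_trans (pC i j (fun=> false)). Qed.

Lemma osc_le_ge0 f u : osc_le f u -> forall i, 0 <= u i.
Proof. by move=> fu i; apply: le_trans (fu i (fun=> false)). Qed.

Lemma p_set_spin i v s : p i (set_spin i v s) = p i s.
Proof. by rewrite set_spinE; case: ifP => // _; exact: pflip. Qed.

Lemma bmeas_set_spin i v f : bmeas f -> bmeas (fun s => f (set_spin i v s)).
Proof.
move=> [mf [M fM]]; split; last by exists M => s.
exact: (measurableT_comp mf (measurable_set_spin i v)).
Qed.

Lemma resample_bmeas i f : bmeas f -> bmeas (resample i f).
Proof.
move=> bf; have bp := quasilocal_bmeas (pql i).
apply: bmeasD; apply: bmeasM => //; try exact: bmeas_set_spin.
by apply: bmeasB => //; exact: bmeas_cst.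
Qed.

Lemma step_bmeas F e f : bmeas f -> bmeas (step F e f).
Proof.
move=> bf; apply: bmeasD => //; apply: bmeasZ; apply: bmeas_sum => i.
by apply: bmeasB => //; exact: resample_bmeas.
Qed.

Lemma quasilocal_set_spin i v f : quasilocal f ->
  quasilocal (fun s => f (set_spin i v s)).
Proof.
move=> qf e /qf[F hF]; exists F => s s' h; apply: hF => j jF.
by rewrite /set_spin; case: ifP => // _; exact: h.
Qed.

Lemma resample_quasilocal i f : quasilocal f -> quasilocal (resample i f).
Proof.
move=> qf; apply: quasilocalD; apply: quasilocalM => //; try exact: quasilocal_set_spin.
by apply: quasilocalB => //; exact: quasilocal_cst.
Qed.

Lemma step_quasilocal F e f : quasilocal f -> quasilocal (step F e f).
Proof.
move=> qf; apply: quasilocalD => //; apply: quasilocalZ; apply: quasilocal_sum => i.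
by apply: quasilocalB => //; exact: resample_quasilocal.
Qed.

Lemma resample_le i f g s : (forall s', f s' <= g s') -> resample i f s <= resample i g s.
Proof.
move=> fg; have /andP[p0 p1] := p01 i s.
by apply: lerD; apply: ler_wpM2l => //; rewrite subr_ge0.
Qed.

Lemma resample_norm i f s : `|resample i f s| <= resample i (fun s' => `|f s'|) s.
Proof.
have /andP[p0 p1] := p01 i s; have p1' : 0 <= 1 - p i s by rewrite subr_ge0.
by rewrite (le_trans (ler_normD _ _))// !normrM !(ger0_norm p0) !(ger0_norm p1').
Qed.

(** For $0 \le e$ and $e|F| \le 1$ this is a convex combination of [f] and its resamplings, the
    source of positivity and of all contraction estimates. *)
Lemma stepE F e f s : step F e f s =
  (1 - e * (size F)%:R) * f s + e * \sum_(i <- F) resample i f s.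
Proof.
rewrite /step sumrB big_const_seq count_predT iter_addr_0 -[f s *+ _]mulr_natr.
by ring.
Qed.

Lemma step_norm F e f s : 0 <= e -> e * (size F)%:R <= 1 ->
  `|step F e f s| <= step F e (fun s' => `|f s'|) s.
Proof.
move=> e0 eF; have eF' : 0 <= 1 - e * (size F)%:R by rewrite subr_ge0.
rewrite !stepE (le_trans (ler_normD _ _))// !normrM (ger0_norm e0) (ger0_norm eF').
rewrite lerD2l ler_wpM2l//.
by rewrite (le_trans (ler_norm_sum _ _ _))// ler_sum// => i _; exact: resample_norm.
Qed.

Lemma resample_cst i a s : resample i (fun=> a) s = a.
Proof. by rewrite /resample; ring. Qed.

Lemma step_bound F e f M : 0 <= e -> e * (size F)%:R <= 1 ->
  (forall s, `|f s| <= M) -> forall s, `|step F e f s| <= M.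
Proof.
move=> e0 eF fM s; apply: (le_trans (step_norm f s e0 eF)).
have M0 : 0 <= M by apply: le_trans (fM s).
have eF' : 0 <= 1 - e * (size F)%:R by rewrite subr_ge0.
rewrite stepE.
apply: (@le_trans _ _ ((1 - e * (size F)%:R) * M + e * \sum_(i <- F) M)).
  rewrite lerD// ler_wpM2l// ler_sum// => i _.
  by rewrite -[leRHS](resample_cst i M s); exact: resample_le.
rewrite big_const_seq count_predT iter_addr_0 -[M *+ _]mulr_natr.
by rewrite le_eqVlt; apply/orP; left; apply/eqP; ring.
Qed.

Lemma stepB F e f g s : step F e (fun s' => f s' - g s') s = step F e f s - step F e g s.
Proof.
rewrite /step [in RHS]opprD [in RHS]addrACA -mulrBr -sumrB; congr (_ + e * _).
by apply: eq_bigr => i _; rewrite /resample; ring.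
Qed.

(** At [j = i] the resampled function no longer depends on the spin, and the nonnegative
    [C i i * u i] is slack. At [j != i] the two values of [f] move by at most [u j] and the weight
    [p i] by at most [C i j], the latter multiplying a difference bounded by [u i]. *)
Lemma resample_osc i f u : osc_le f u ->
  osc_le (resample i f) (fun j => u j + (C i j * u i - (i == j)%:R * u j)).
Proof.
move=> fu j s; have u0 := osc_le_ge0 fu.
have [->|ij] := eqVneq i j.
  rewrite /resample pflip !set_spin_flip subrr normr0 mul1r addrCA subrr addr0.
  by rewrite mulr_ge0// C_ge0.
have ji : j != i by rewrite eq_sym.
rewrite mul0r subr0 /resample !set_spin_flipC//.
set a := f (set_spin i true s); set b := f (set_spin i false s).
have ha := fu j (set_spin i true s); have hb := fu j (set_spin i false s).
rewrite -/a in ha; rewrite -/b in hb.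
set a' := f (flip j (set_spin i true s)) in ha *.
set b' := f (flip j (set_spin i false s)) in hb *.
have hab : `|a - b| <= u i by have := fu i (set_spin i false s); rewrite flip_set_spin.
have hp := pC i j s; have /andP[p0 p1] := p01 i (flip j s).
move: hp p0 p1; move: (p i s) (p i (flip j s)) => P P' hp p0 p1.
have -> : P' * a' + (1 - P') * b' - (P * a + (1 - P) * b) =
  (P' * (a' - a) + (1 - P') * (b' - b)) + (P' - P) * (a - b) by ring.
rewrite (le_trans (ler_normD _ _))// lerD//; last by rewrite normrM ler_pM.
have p1' : 0 <= 1 - P' by rewrite subr_ge0.
rewrite (le_trans (ler_normD _ _))// !normrM (ger0_norm p0) (ger0_norm p1').
have -> : u j = P' * u j + (1 - P') * u j by ring.
by apply: lerD; apply: ler_wpM2l.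
Qed.

Lemma step_osc F e f u : 0 <= e -> e * (size F)%:R <= 1 -> osc_le f u ->
  osc_le (step F e f) (vstep F e u).
Proof.
move=> e0 eF fu j s; have eF' : 0 <= 1 - e * (size F)%:R by rewrite subr_ge0.
rewrite !stepE.
have -> : (1 - e * (size F)%:R) * f (flip j s) + e * \sum_(i <- F) resample i f (flip j s)
  - ((1 - e * (size F)%:R) * f s + e * \sum_(i <- F) resample i f s) =
  (1 - e * (size F)%:R) * (f (flip j s) - f s) +
  e * \sum_(i <- F) (resample i f (flip j s) - resample i f s).
  by rewrite sumrB; ring.
rewrite (le_trans (ler_normD _ _))// !normrM (ger0_norm e0) (ger0_norm eF').
apply: (@le_trans _ _ ((1 - e * (size F)%:R) * u j +
    e * \sum_(i <- F) (u j + (C i j * u i - (i == j)%:R * u j)))).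
  rewrite lerD// ler_wpM2l// (le_trans (ler_norm_sum _ _ _))// ler_sum// => i _.
  exact: resample_osc.
rewrite /vstep big_split/= big_const_seq count_predT iter_addr_0 -[u j *+ _]mulr_natr.
by rewrite le_eqVlt; apply/orP; left; apply/eqP; ring.
Qed.

Lemma iter_step_bmeas F e f k : bmeas f -> bmeas (iter k (step F e) f).
Proof. by move=> bf; elim: k => //= k IH; exact: step_bmeas. Qed.

Lemma iter_step_quasilocal F e f k : quasilocal f -> quasilocal (iter k (step F e) f).
Proof. by move=> bf; elim: k => //= k IH; exact: step_quasilocal. Qed.

Lemma iter_step_bound F e f M k : 0 <= e -> e * (size F)%:R <= 1 ->
  (forall s, `|f s| <= M) -> forall s, `|iter k (step F e) f s| <= M.
Proof. by move=> e0 eF fM; elim: k => //= k IH; exact: step_bound. Qed.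

Lemma iter_step_osc F e f u k : 0 <= e -> e * (size F)%:R <= 1 -> osc_le f u ->
  osc_le (iter k (step F e) f) (iter k (vstep F e) u).
Proof. by move=> e0 eF fu; elim: k => //= k IH; exact: step_osc. Qed.

Lemma vstep_ge0 F e u : 0 <= e -> e * (size F)%:R <= 1 ->
  (forall i, 0 <= u i) -> forall j, 0 <= vstep F e u j.
Proof.
move=> e0 eF u0 j; rewrite /vstep.
apply: (@le_trans _ _ (u j + e * \sum_(i <- F) (- u j))).
  rewrite sumrN big_const_seq count_predT iter_addr_0 -[u j *+ _]mulr_natr.
  have -> : u j + e * - (u j * (size F)%:R) = (1 - e * (size F)%:R) * u j by ring.
  by rewrite mulr_ge0// subr_ge0.
rewrite lerD2l ler_wpM2l// ler_sum// => i _.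
have := u0 j; have : 0 <= C i j * u i by rewrite mulr_ge0// C_ge0.
by case: (i == j) => /=; rewrite ?mul1r ?mul0r; lra.
Qed.

Lemma iter_vstep_ge0 F e u k : 0 <= e -> e * (size F)%:R <= 1 ->
  (forall i, 0 <= u i) -> forall j, 0 <= iter k (vstep F e) u j.
Proof. by move=> e0 eF u0; elim: k => //= k IH; exact: vstep_ge0. Qed.

(** Since $C^T w \le w$, each step costs at most a factor $1 + e$. The bound must also hold at sites
    outside [F], which are never resampled but receive oscillation from [F]; hence growth instead of
    decay. *)
Lemma iter_vstep_dom F e u w k : 0 <= e -> e * (size F)%:R <= 1 ->
  (forall i, 0 <= u i <= w i) ->
  (forall G : {fset site d}, forall j, \sum_(i <- G) C i j * w i <= w j) ->
  forall j, iter k (vstep F e) u j <= (1 + e) ^+ k * w j.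
Proof.
move=> e0 eF uw Cw; have u0 i : 0 <= u i by have /andP[] := uw i.
elim: k => [j|k IH j] /=; first by rewrite expr0 mul1r; have /andP[] := uw j.
have v0 := iter_vstep_ge0 k e0 eF u0.
move: IH v0; move: (iter k _ _) => v IH v0.
have K0 : 0 <= (1 + e) ^+ k by rewrite exprn_ge0// addr_ge0.
rewrite /vstep exprS.
apply: (@le_trans _ _ ((1 + e) ^+ k * w j + e * ((1 + e) ^+ k * w j))); last first.
  by rewrite le_eqVlt; apply/orP; left; apply/eqP; ring.
rewrite lerD// ler_wpM2l//.
apply: (@le_trans _ _ (\sum_(i <- F) ((1 + e) ^+ k * (C i j * w i)))); last first.
  by rewrite -mulr_sumr ler_wpM2l.
apply: ler_sum => i _.
have h1 : 0 <= (i == j)%:R * v j by rewrite mulr_ge0.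
have h2 : C i j * v i <= C i j * ((1 + e) ^+ k * w i) by rewrite ler_wpM2l// C_ge0.
by rewrite [leRHS]mulrCA; lra.
Qed.

Lemma vstepE F e u j : j \in F ->
  vstep F e u j = (1 - e) * u j + e * \sum_(i <- F) C i j * u i.
Proof.
move=> jF; rewrite /vstep sumrB.
have -> : \sum_(i <- F) (i == j)%:R * u j = u j.
  rewrite (big_fsetD1 j)//= eqxx mul1r big_seq big1 ?addr0// => i.
  by rewrite !inE => /andP[/negbTE -> _]; rewrite mul0r.
by ring.
Qed.

Hypothesis q01 : 0 < q < 1.
Hypothesis Crow : forall F i, \sum_(j <- F) C i j <= q.
Hypothesis Ccol : forall F j, \sum_(i <- F) C i j <= q.

(** Each site of [F] loses the fraction [e] of its oscillation and, by the row sums, passes on at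
    most [e * q] of it within [F]. *)
Lemma vstep_l1 F e u : 0 <= e -> (forall i, 0 <= u i) ->
  \sum_(j <- F) vstep F e u j <= (1 - e * (1 - q)) * \sum_(j <- F) u j.
Proof.
move=> e0 u0; rewrite big_seq.
rewrite (eq_bigr (fun j => (1 - e) * u j + e * \sum_(i <- F) C i j * u i)); last first.
  by move=> j; exact: vstepE.
rewrite -big_seq big_split/= -!mulr_sumr.
have : \sum_(j <- F) \sum_(i <- F) C i j * u i <= q * \sum_(i <- F) u i.
  rewrite exchange_big mulr_sumr ler_sum// => i _.
  by rewrite -mulr_suml ler_wpM2r.
move=> /(ler_wpM2l e0); lra.
Qed.

(** Expand the weighted sum of $(u_i - b/q)^2$, which is nonnegative. Subtracting $b/q$ instead of
    the weighted mean requires only the upper bound [q] on the column sum, which may itself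
    vanish. *)
Lemma weighted_cauchy_schwarz F j u : 
  (\sum_(i <- F) C i j * u i) ^+ 2 <= q * \sum_(i <- F) C i j * u i ^+ 2.
Proof.
have /andP[q0 _] := q01.
set b := \sum_(i <- F) C i j * u i.
have : 0 <= \sum_(i <- F) C i j * (u i - b / q) ^+ 2.
  by apply: sumr_ge0 => i _; rewrite mulr_ge0 ?C_ge0// sqr_ge0.
have -> : \sum_(i <- F) C i j * (u i - b / q) ^+ 2 =
   \sum_(i <- F) C i j * u i ^+ 2 - 2 * (b / q) * b
   + (b / q) ^+ 2 * \sum_(i <- F) C i j.
  rewrite /b !mulr_sumr -sumrB -big_split/=.
  by apply: eq_bigr => i _; rewrite -/b; ring.
have h := ler_wpM2l (sqr_ge0 (b / q)) (Ccol F j).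
move=> h2.
have {h h2} : 0 <= \sum_(i <- F) C i j * u i ^+ 2 - 2 * (b / q) * b + (b / q) ^+ 2 * q by lra.
have -> : - (2 * (b / q) * b) = - (2 * (b ^+ 2 / q)) by ring.
have -> : (b / q) ^+ 2 * q = b ^+ 2 / q by field; rewrite gt_eqF.
by move=> h; rewrite mulrC -ler_pdivrMr//; lra.
Qed.

(** Convexity of the square splits each new entry into $u_j^2$ and the square of the incoming
    oscillation. Column sums bound that square, and row sums then bound its total over [j]. *)
Lemma vstep_l2 F e u : 0 <= e <= 1 ->
  \sum_(j <- F) vstep F e u j ^+ 2 <= (1 - e * (1 - q)) * \sum_(j <- F) u j ^+ 2.
Proof.
move=> /andP[e0 e1]; have /andP[q0 q1] := q01; rewrite big_seq.
apply: (@le_trans _ _ (\sum_(j <- F) ((1 - e) * u j ^+ 2 +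
    e * (q * \sum_(i <- F) C i j * u i ^+ 2)))).
  rewrite [leRHS]big_seq ler_sum// => j jF; rewrite vstepE//.
  have h := ler_wpM2l e0 (weighted_cauchy_schwarz F j u).
  move: h; set b := \sum_(i <- F) C i j * u i; move=> h.
  have h2 : 0 <= e * (1 - e) * (u j - b) ^+ 2.
    by rewrite mulr_ge0 ?sqr_ge0// mulr_ge0// subr_ge0.
  suff : ((1 - e) * u j + e * b) ^+ 2 <= (1 - e) * u j ^+ 2 + e * b ^+ 2 by lra.
  rewrite -subr_ge0 (_ : _ - _ = e * (1 - e) * (u j - b) ^+ 2)//; ring.
rewrite big_split/= -!mulr_sumr.
have S0 : 0 <= \sum_(i <- F) u i ^+ 2 by apply: sumr_ge0 => i _; exact: sqr_ge0.
have : \sum_(j <- F) \sum_(i <- F) C i j * u i ^+ 2 <= q * \sum_(i <- F) u i ^+ 2.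
  rewrite exchange_big mulr_sumr ler_sum// => i _.
  by rewrite -mulr_suml ler_wpM2r// sqr_ge0.
move=> /(ler_wpM2l (ltW q0))/(ler_wpM2l e0).
(* Columns and rows together give $q^2$; it is weakened to $q$, the rate obtained for plain sums. *)
have : e * (q * (q * \sum_(i <- F) u i ^+ 2)) <= e * (q * \sum_(i <- F) u i ^+ 2).
  rewrite ler_wpM2l// ler_wpM2l ?(ltW q0)// ler_piMl//; exact: ltW.
lra.
Qed.

Lemma rate_ge0 e : 0 <= e <= 1 -> 0 <= 1 - e * (1 - q).
Proof. by move=> /andP[? ?]; have /andP[? ?] := q01; nra. Qed.

Lemma iter_vstep_l1 F e u k : 0 <= e <= 1 -> e * (size F)%:R <= 1 ->
  (forall i, 0 <= u i) ->
  \sum_(j <- F) iter k (vstep F e) u j <= (1 - e * (1 - q)) ^+ k * \sum_(j <- F) u j.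
Proof.
move=> e01 eF u0; have /andP[e0 e1] := e01.
elim: k => [|k IH]; first by rewrite expr0 mul1r.
rewrite iterS (le_trans (vstep_l1 F e0 (iter_vstep_ge0 k e0 eF u0)))//.
by rewrite exprS -mulrA ler_wpM2l// rate_ge0.
Qed.

Lemma iter_vstep_l2 F e u k : 0 <= e <= 1 ->
  \sum_(j <- F) iter k (vstep F e) u j ^+ 2 <=
  (1 - e * (1 - q)) ^+ k * \sum_(j <- F) u j ^+ 2.
Proof.
move=> e01; elim: k => [|k IH]; first by rewrite expr0 mul1r.
rewrite iterS (le_trans (vstep_l2 F _ e01))//.
by rewrite exprS -mulrA ler_wpM2l// rate_ge0.
Qed.

End DiscreteHeatBath.

(** * Invariance and exponential moments along the discrete evolution *)

Section StationaryHeatBath.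
Variables (R : realType) (d : nat) (p : site d -> config d -> R)
  (C : site d -> site d -> R) (q : R) (m : {measure set (config d) -> \bar R}).
Implicit Types (i j : site d) (s : config d) (F : {fset site d})
  (f g h : config d -> R) (u w : site d -> R).
Hypothesis m1 : m setT = 1%E.
Hypothesis p01 : forall i s, 0 <= p i s <= 1.
Hypothesis pflip : forall i s, p i (flip i s) = p i s.
Hypothesis pql : forall i, quasilocal (p i).
Hypothesis pC : forall i j s, `|p i (flip j s) - p i s| <= C i j.
Hypothesis inv : forall i f, bmeas f -> Ex m (resample p i f) = Ex m f.

Let step_bm F (e : R) f : bmeas f -> bmeas (step p F e f).
Proof. exact: step_bmeas. Qed.

Let resample_bm i f : bmeas f -> bmeas (resample p i f).
Proof. exact: resample_bmeas. Qed.

Lemma Ex_step F (e : R) f : bmeas f -> Ex m (step p F e f) = Ex m f.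
Proof.
move=> bf.
have bD i : bmeas (fun s => resample p i f s - f s).
  by apply: bmeasB => //; exact: resample_bm.
rewrite /step ExD//; last by apply: bmeasZ; exact: bmeas_sum.
rewrite ExZ//; last exact: bmeas_sum.
rewrite Ex_sum// big1 ?mulr0 ?addr0// => i _.
by rewrite ExB// ?inv ?subrr//; exact: resample_bm.
Qed.

Lemma Ex_iter_step F (e : R) f k : bmeas f -> Ex m (iter k (step p F e) f) = Ex m f.
Proof.
by move=> bf; elim: k => //= k <-; rewrite Ex_step//; exact: iter_step_bmeas.
Qed.

(** A positive operator that preserves [m] contracts $L^1(m)$. *)
Lemma iter_step_contract F (e : R) f g k : 0 <= e -> e * (size F)%:R <= 1 ->
  bmeas f -> bmeas g ->
  Ex m (fun s => `|iter k (step p F e) f s - iter k (step p F e) g s|) <=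
  Ex m (fun s => `|f s - g s|).
Proof.
move=> e0 eF bf bg; elim: k => //= k; apply: le_trans.
have bf' := iter_step_bmeas pql F e k bf; have bg' := iter_step_bmeas pql F e k bg.
move: bf' bg'; move: (iter k _ f) (iter k _ g) => f' g' bf' bg'.
have bD : bmeas (fun s => `|f' s - g' s|) by exact/bmeas_norm/bmeasB.
rewrite -(Ex_step F e bD); apply: le_Ex => //.
- by apply/bmeas_norm/bmeasB; exact: step_bm.
- exact: step_bm.
- by move=> s; rewrite -stepB; exact: step_norm.
Qed.

(** Integrating out the spin at [i] turns the left side into the Dirichlet form
    $p(1-p)(a-b)(e^a-e^b)$, where $a$ and $b$ are the values of [f] at the two spins and differ by
    at most [u i]. *)
Lemma Ex_expR_resample i f u : bmeas f -> osc_le f u ->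
  Ex m (fun s => expR (f s) * (f s - resample p i f s)) <=
  u i ^+ 2 * Ex m (fun s => expR (f s)).
Proof.
move=> bf fu; have bE := bmeas_expR bf; have br := resample_bm i bf.
have bG : bmeas (fun s => expR (f s) * (f s - resample p i f s)).
  by apply: bmeasM => //; exact: bmeasB.
(* Invariance is applied on both sides: once resampled, the two integrands compare pointwise. *)
rewrite -(inv i bG) -(inv i bE) -(ExZ m1); last exact: resample_bm.
apply: le_Ex => // [||s]; first exact: resample_bm.
  by apply: bmeasZ; exact: resample_bm.
rewrite /resample !set_spin_set !(p_set_spin pflip).
set a := f (set_spin i true s); set b := f (set_spin i false s).
have /andP[p0 p1] := p01 i s; move: (p i s) p0 p1 => P p0 p1.
have hab : `|a - b| <= u i by have := fu i (set_spin i false s); rewrite flip_set_spin.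
have -> : P * (expR a * (a - (P * a + (1 - P) * b))) +
   (1 - P) * (expR b * (b - (P * a + (1 - P) * b))) =
   P * (1 - P) * ((a - b) * (expR a - expR b)) by ring.
have u0 := normr_ge0 (a - b).
have hab2 : (a - b) ^+ 2 <= u i ^+ 2.
  by rewrite -(real_normK (num_real (a - b))) lerXn2r// nnegrE// (le_trans u0).
have ea := expR_gt0 a; have eb := expR_gt0 b.
have ha : expR a * (1 + (b - a)) <= expR b.
  by rewrite -[X in _ <= expR X](subrK a b) expRD mulrC ler_wpM2r ?expR_ge1Dx// ltW.
have hb : expR b * (1 + (a - b)) <= expR a.
  by rewrite -[X in _ <= expR X](subrK b a) expRD mulrC ler_wpM2r ?expR_ge1Dx// ltW.
have p1' : 0 <= 1 - P by rewrite subr_ge0.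
have key : (a - b) * (expR a - expR b) <= (a - b) ^+ 2 * (expR a + expR b).
  have sA := mulr_ge0 (sqr_ge0 (a - b)) (ltW ea).
  have sB := mulr_ge0 (sqr_ge0 (a - b)) (ltW eb).
  case: (leP a b) => ab.
    have ab' : 0 <= b - a by rewrite subr_ge0.
    by have := ler_wpM2l ab' hb; lra.
  have ab' : 0 <= a - b by rewrite subr_ge0 ltW.
  by have := ler_wpM2l ab' ha; lra.
apply: (@le_trans _ _ (P * (1 - P) * (u i ^+ 2 * (expR a + expR b)))).
  by rewrite ler_wpM2l ?mulr_ge0// (le_trans key)// ler_wpM2r// addr_ge0// ltW.
(* There remains $p(1-p)(e^a+e^b) \le p e^a + (1-p)e^b$, whose two sides differ by $p^2e^a +
   (1-p)^2e^b$. *)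
rewrite mulrCA ler_wpM2l ?sqr_ge0//.
have := mulr_ge0 (mulr_ge0 p0 p0) (ltW ea).
have := mulr_ge0 (mulr_ge0 p1' p1') (ltW eb); lra.
Qed.

(** The tangent inequality $e^{Kf} \ge e^f(1 + Kf - f)$ is linear in the increments
    [f - resample p i f], so the single-site estimates add up over [F]. *)
Lemma Ex_expR_step F (e : R) f u : 0 <= e -> bmeas f -> osc_le f u ->
  (1 - e * \sum_(i <- F) u i ^+ 2) * Ex m (fun s => expR (f s)) <=
  Ex m (fun s => expR (step p F e f s)).
Proof.
move=> e0 bf fu; have bE := bmeas_expR bf; have br i := resample_bm i bf.
have bS := step_bm F e bf.
have bD i : bmeas (fun s => expR (f s) * (f s - resample p i f s)).
  by apply: bmeasM => //; exact: bmeasB.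
have bDs : bmeas (fun s => \sum_(i <- F) expR (f s) * (f s - resample p i f s)).
  exact: bmeas_sum.
apply: (@le_trans _ _ (Ex m (fun s => expR (f s) -
    e * \sum_(i <- F) expR (f s) * (f s - resample p i f s)))).
  rewrite ExB//; last exact: bmeasZ.
  rewrite ExZ// Ex_sum// mulrBl mul1r lerD2l lerN2 -mulrA ler_wpM2l//.
  by rewrite mulr_suml ler_sum// => i _; exact: Ex_expR_resample.
apply: le_Ex => // [||s].
- by apply: bmeasB => //; exact: bmeasZ.
- exact: bmeas_expR.
have -> : expR (f s) - e * \sum_(i <- F) expR (f s) * (f s - resample p i f s) =
    expR (f s) * (1 + (step p F e f s - f s)).
  rewrite /step -mulr_sumr [f s + _ - _]addrAC subrr add0r.
  have -> : \sum_(i <- F) (resample p i f s - f s) =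
      - \sum_(i <- F) (f s - resample p i f s).
    by rewrite -sumrN; apply: eq_bigr => i _; rewrite opprB.
  by ring.
rewrite -[X in _ <= expR X](subrK (f s)) [leRHS]expRD mulrC ler_wpM2r ?expR_ge0//.
exact: expR_ge1Dx.
Qed.

Hypothesis q01 : 0 < q < 1.
Hypothesis Crow : forall F i, \sum_(j <- F) C i j <= q.
Hypothesis Ccol : forall F j, \sum_(i <- F) C i j <= q.

(* The factors [1 - x >= exp (- 2 x)], [x <= 1/2], multiply up along the geometric
   series [e * \sum_k (1 - e * (1 - q)) ^+ k = 1 / (1 - q)]. *)
Lemma Ex_expR_iter_step F (e : R) k f u (D : R) :
  0 <= e <= 1 -> e * (size F)%:R <= 1 -> bmeas f -> osc_le f u ->
  \sum_(i <- F) u i ^+ 2 <= D -> e * D <= 1 / 2 ->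
  Ex m (fun s => expR (f s)) <=
  expR (2 / (1 - q) * D) * Ex m (fun s => expR (iter k (step p F e) f s)).
Proof.
move=> e01 eF; have /andP[e0 e1] := e01; have /andP[q0 q1] := q01.
have k0 : 0 < 1 - q by rewrite subr_gt0.
have E0 g : bmeas g -> 0 <= Ex m (fun s => expR (g s)).
  by move=> bg; apply: (Ex_ge_cst m1 (bmeas_expR bg)) => s; exact: expR_ge0.
have sumsq_ge0 v E : \sum_(i <- F) v i ^+ 2 <= E -> 0 <= E :> R.
  by apply: le_trans; apply: sumr_ge0 => i _; exact: sqr_ge0.
elim: k f u D => [|k IH] f u D bf fu uD eD.
  rewrite /= -[leLHS]mul1r ler_wpM2r ?E0//.
  have D0 := sumsq_ge0 _ _ uD; have k1 : 0 <= 2 / (1 - q) by rewrite divr_ge0 ?(ltW k0).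
  by rewrite -[leLHS]expR0 ler_expR mulr_ge0.
have D0 := sumsq_ge0 _ _ uD.
have rate := rate_ge0 q01 e01.
have bS := step_bm F e bf.
have H := IH _ _ ((1 - e * (1 - q)) * D) bS (step_osc p01 pflip pC e0 eF fu).
rewrite -iterSr in H.
have H1 : \sum_(i <- F) vstep C F e u i ^+ 2 <= (1 - e * (1 - q)) * D.
  apply: (le_trans (vstep_l2 pC q01 Crow Ccol F u e01)).
  by rewrite ler_wpM2l.
have H2 : e * ((1 - e * (1 - q)) * D) <= 1 / 2.
  apply: le_trans eD; rewrite ler_wpM2l// ler_piMl//.
  by rewrite gerDl oppr_le0 mulr_ge0// ltW.
have {}H := H H1 H2.
set A := Ex m (fun s => expR (f s)) in H *.
set B := Ex m (fun s => expR (step p F e f s)) in H *.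
have hAB : (1 - e * D) * A <= B.
  apply: le_trans (Ex_expR_step F e0 bf fu).
  by rewrite ler_wpM2r ?E0// lerD2l lerN2 ler_wpM2l.
(* The cost [2 * (e * D)] of the first step plus the cost of the remaining ones, which start from
   the contracted bound. *)
have -> : 2 / (1 - q) * D = 2 * (e * D) + 2 / (1 - q) * ((1 - e * (1 - q)) * D).
  by field; rewrite gt_eqF.
rewrite expRD -mulrA.
have x0 : 0 <= e * D by rewrite mulr_ge0.
move: eD x0 hAB; set x := e * D => eD x0 hAB.
apply: (@le_trans _ _ (expR (2 * x) * B)); last by rewrite ler_wpM2l// expR_ge0.
apply: (@le_trans _ _ (expR (2 * x) * ((1 - x) * A))); last first.
  by rewrite ler_wpM2l// expR_ge0.
rewrite mulrA -[leLHS]mul1r ler_wpM2r ?E0//.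
(* $(1 + 2x)(1 - x) = 1 + x(1 - 2x) \ge 1$ for $0 \le x \le 1/2$. *)
have := expR_ge1Dx (2 * x); have := expR_gt0 (2 * x); nra.
Qed.

Lemma Ex_expR_lip f g M : bmeas f -> bmeas g ->
  (forall s, `|f s| <= M) -> (forall s, `|g s| <= M) ->
  Ex m (fun s => expR (f s)) <=
  Ex m (fun s => expR (g s)) + expR M * Ex m (fun s => `|f s - g s|).
Proof.
move=> bf bg fM gM.
have bD : bmeas (fun s => `|f s - g s|) by exact/bmeas_norm/bmeasB.
rewrite -ExZ// -ExD//; [|exact: bmeas_expR|exact: bmeasZ].
apply: le_Ex => // [||s]; first exact: bmeas_expR.
  by apply: bmeasD; [exact: bmeas_expR|exact: bmeasZ].
have h : expR (f s) * (1 + (g s - f s)) <= expR (g s).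
  by rewrite -[X in _ <= expR X](subrK (f s)) expRD mulrC ler_wpM2r ?expR_ge1Dx// expR_ge0.
have h2 : expR (f s) * (f s - g s) <= expR M * `|f s - g s|.
  apply: (@le_trans _ _ (expR (f s) * `|f s - g s|)).
    by rewrite ler_wpM2l ?expR_ge0// ler_norm.
  by rewrite ler_wpM2r// ler_expR (le_trans (ler_norm _))// fM.
lra.
Qed.

End StationaryHeatBath.

(** * Oscillations in infinite volume *)

Section SuperharmonicMajorant.
Variables (R : realType) (d : nat) (C : site d -> site d -> R) (q : R).
Hypothesis C0 : forall i j, 0 <= C i j.
Hypothesis q01 : 0 < q < 1.
Hypothesis Crow : forall (F : {fset site d}) i, \sum_(j <- F) C i j <= q.

Lemma esum_scale_le (T : choiceType) (c : R) (a : T -> \bar R) : 0 <= c ->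
  (forall t, (0 <= a t)%E) ->
  (\esum_(t in [set: T]) (c%:E * a t) <= c%:E * \esum_(t in [set: T]) a t)%E.
Proof.
move=> c0 a0; apply: ge_ereal_sup => _ [X [finX _] <-].
rewrite fsbig_finite//= -ge0_sume_distrr; last by move=> t _; exact: a0.
rewrite lee_wpmul2l ?lee_fin//; apply: esum_ge.
by exists X => //; rewrite fsbig_finite.
Qed.

Lemma esum_scale_ge (T : choiceType) (c : R) (a : T -> \bar R) : 0 <= c ->
  (forall t, (0 <= a t)%E) ->
  (c%:E * (\esum_(t in [set: T]) a t) <= \esum_(t in [set: T]) (c%:E * a t))%E.
Proof.
move=> c0 a0; have [->|cn0] := eqVneq c 0.
  by rewrite mul0e esum_ge0// => t _; rewrite mul0e.
have cp : 0 < c by rewrite lt_def cn0.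
have ca0 t : (0 <= c%:E * a t)%E by rewrite mule_ge0// lee_fin.
have ci : 0 <= c^-1 by rewrite invr_ge0.
have := esum_scale_le ci ca0.
have -> : (\esum_(t in [set: T]) (c^-1%:E * (c%:E * a t)) = \esum_(t in [set: T]) a t)%E.
  by apply: eq_esum => t _; rewrite muleA -EFinM mulVf// mul1e.
move=> h; apply: (@le_trans _ _ (c%:E * (c^-1%:E * \esum_(t in [set: T]) (c%:E * a t)))%E).
  by rewrite lee_wpmul2l// lee_fin.
by rewrite muleA -EFinM mulfV// mul1e.
Qed.

(** The vector $(C^T)^n u$, with extended real entries because finiteness is only known after
    summing over all sites. *)
Fixpoint neumann (u : site d -> R) (n : nat) (j : site d) : \bar R :=
  if n is n'.+1 then \esum_(i in [set: site d]) ((C i j)%:E * neumann u n' i)%E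
  else (u j)%:E.

(* The Neumann series [\sum_n (C^T)^n u] dominates, up to a scalar factor, the
   oscillations of all iterates of the discrete heat bath started from [u]. *)
Lemma superharmonic_majorant (u : site d -> R) : (forall i, 0 <= u i) ->
  (\esum_(i in [set: site d]) (u i)%:E < +oo)%E ->
  exists w : site d -> R, [/\ forall i, 0 <= u i <= w i,
    forall (G : {fset site d}) j, \sum_(i <- G) C i j * w i <= w j &
    (\esum_(i in [set: site d]) (w i)%:E < +oo)%E].
Proof.
move=> u0 uoo; have /andP[q0 q1] := q01.
pose v := neumann u.
have v0 n j : (0 <= v n j)%E.
  elim: n j => [|n IH] j; first by rewrite lee_fin.
  by apply: esum_ge0 => i _; rewrite mule_ge0// lee_fin.
have ufin : (\esum_(i in [set: site d]) (u i)%:E)%E \is a fin_num.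
  by rewrite ge0_fin_numE// esum_ge0// => i _; rewrite lee_fin.
pose Us := fine (\esum_(i in [set: site d]) (u i)%:E)%E.
have Us0 : 0 <= Us by apply: fine_ge0; apply: esum_ge0 => i _; rewrite lee_fin.
(* By the row sums, one application of $C^T$ multiplies the total mass by at most [q]. *)
have vtot n : (\esum_(i in [set: site d]) v n i <= (q ^+ n * Us)%:E)%E.
  elim: n => [|n IH]; first by rewrite expr0 mul1r /Us fineK.
  apply: ge_ereal_sup => _ [X [finX _] <-]; rewrite fsbig_finite//=.
  rewrite -esum_sum; last by move=> i j _ _; rewrite mule_ge0// lee_fin.
  apply: (@le_trans _ _ (\esum_(i in [set: site d]) (q%:E * v n i))%E).
    apply: le_esum => i _; rewrite -ge0_sume_distrl; last by move=> j _; rewrite lee_fin.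
    by rewrite lee_wpmul2r// sumEFin lee_fin.
  apply: (le_trans (esum_scale_le (ltW q0) (v0 n))).
  by rewrite exprS -mulrA EFinM lee_wpmul2l// lee_fin ltW.
pose w j : \bar R := (\esum_(n in [set: nat]) v n j)%E.
have w0 j : (0 <= w j)%E by apply: esum_ge0 => n _.
have wtot : (\esum_(j in [set: site d]) w j <= (Us / (1 - q))%:E)%E.
  apply: ge_ereal_sup => _ [X [finX _] <-]; rewrite fsbig_finite//=.
  rewrite -esum_sum; last by move=> *.
  apply: (@le_trans _ _ (\esum_(n in [set: nat]) (q ^+ n * Us)%:E)%E).
    apply: le_esum => n _; apply: le_trans (vtot n); apply: esum_ge.
    by exists X => //; rewrite fsbig_finite.
  rewrite -nneseries_esumT; last first.
    by move=> n; rewrite lee_fin mulr_ge0// exprn_ge0// ltW.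
  apply: lime_le.
    by apply: is_cvg_nneseries => n _ _; rewrite lee_fin mulr_ge0// exprn_ge0// ltW.
  apply: nearW => n; rewrite sumEFin lee_fin ler_pdivlMr ?subr_gt0//.
  have -> : (\sum_(0 <= i < n) q ^+ i * Us) * (1 - q) = Us * (1 - q ^+ n).
    elim: n => [|n IH]; first by rewrite big_geq// expr0 subrr mul0r mulr0.
    by rewrite big_nat_recr//= mulrDl IH exprSr; ring.
  by rewrite ler_piMr// gerBl exprn_ge0// ltW.
have wfin j : w j \is a fin_num.
  rewrite ge0_fin_numE//; apply: le_lt_trans (ltry (Us / (1 - q))).
  apply: le_trans wtot; apply: esum_ge; exists [set j] => //.
  by rewrite fsbig_set1.
exists (fun j => fine (w j)); split.
- move=> i; rewrite u0/= -lee_fin fineK//; apply: esum_ge; exists [set 0%N] => //.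
  by rewrite fsbig_set1.
- move=> G j; rewrite -lee_fin fineK// -sumEFin.
  apply: (@le_trans _ _ (\sum_(i <- G) \esum_(n in [set: nat]) ((C i j)%:E * v n i))%E).
    by apply: lee_sum => i _; rewrite EFinM fineK//; exact: esum_scale_ge.
  rewrite -esum_sum; last by move=> n i _ _; rewrite mule_ge0// lee_fin.
  (* $C^T$ shifts the series by one index, so its image is the series without its zeroth term. *)
  apply: (@le_trans _ _ (\esum_(n in [set: nat]) v n.+1 j)%E).
    apply: le_esum => n _; apply: esum_ge; exists [set` G] => //.
    by rewrite fsbig_finite//= set_fsetK.
  apply: ge_ereal_sup => _ [X [finX _] <-]; apply: esum_ge.
  exists (S @` X); first by split => //; exact: finite_image.
  by rewrite [leRHS](reindex_fsbig S X)//; split=> // ? ? _ _ [].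
- rewrite (@eq_esum _ _ _ _ w) => [|i _]; last by rewrite fineK.
  exact: le_lt_trans wtot (ltry _).
Qed.

End SuperharmonicMajorant.

(** * Oscillations and truncation to a finite window *)

Section Oscillation.
Variables (R : realType) (d : nat).
Implicit Types (i j : site d) (s : config d) (A B F G : {fset site d})
  (f g h : config d -> R) (u w : site d -> R).

Definition tail_le w A (tau : R) :=
  forall B, (forall i, i \in B -> i \notin A) -> \sum_(i <- B) w i <= tau.

Lemma tail_leS w A A' tau : (A `<=` A')%fset -> tail_le w A tau -> tail_le w A' tau.
Proof.
move=> /fsubsetP AA' h B BA'; apply: h => i /BA'; apply: contra; exact: AA'.
Qed.

Lemma summable_tail w : (forall i, 0 <= w i) ->
  (\esum_(i in [set: site d]) (w i)%:E < +oo)%E ->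
  forall e : R, 0 < e -> exists A, tail_le w A e.
Proof.
move=> w0 woo e e0.
have [|X _ hX] := @esum_tail R _ [set: site d] (fun i => (w i)%:E) _ woo e e0.
  by move=> i _; rewrite lee_fin.
exists X => B BX; rewrite -lee_fin; apply: le_trans hX; apply: esum_ge.
exists [set` B]; first by split => // i /= /BX /negP.
by rewrite fsbig_finite//= set_fsetK sumEFin.
Qed.

Lemma osc_set_spin g u i v s : osc_le g u -> `|g (set_spin i v s) - g s| <= u i.
Proof.
move=> gu; rewrite set_spinE; case: ifP => _; last exact: gu.
by rewrite subrr normr0; exact: osc_le_ge0 gu i.
Qed.

Lemma osc_mix g u B s s' : osc_le g u ->
  `|g (mix B s s') - g s'| <= \sum_(i <- B) u i.
Proof.
move=> gu.
have -> : mix B s s' = fun j => if j \in enum_fset B then s j else s' j by [].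
elim: (enum_fset B) => [|i l IH]; first by rewrite big_nil /= subrr normr0.
rewrite big_cons.
have -> : (fun j => if j \in i :: l then s j else s' j) =
    set_spin i (s i) (fun j => if j \in l then s j else s' j) :> config d.
  by apply/funext => j; rewrite /set_spin inE; case: eqVneq => // ->.
apply: le_trans (ler_distD (g (fun j => if j \in l then s j else s' j)) _ _) _.
by apply: lerD => //; exact: osc_set_spin.
Qed.

(** Infinitely many spin changes cannot be telescoped. Quasilocality disposes of all sites outside a
    finite [F], and the spins in [F] but not in [A] are changed one at a time. *)
Lemma osc_tail g u A tau s s' : quasilocal g -> osc_le g u -> tail_le u A tau ->
  agree_on A s s' -> `|g s - g s'| <= tau.
Proof.
move=> qg gu tl h; apply/ler_addgt0Pr => e /qg[F hF].
pose B := (F `\` A)%fset.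
apply: le_trans (ler_distD (g (mix B s s')) _ _) _; rewrite addrC; apply: lerD.
  apply: le_trans (osc_mix _ _ _ gu) _; apply: tl => i.
  by rewrite !inE => /andP[].
apply: hF => i iF; rewrite /mix !inE iF andbT.
by case: ifPn => //; rewrite negbK => /h.
Qed.

Lemma pad_dist g u F tau s : quasilocal g -> osc_le g u -> tail_le u F tau ->
  `|g s - g (pad F s)| <= tau.
Proof.
by move=> qg gu tl; apply: (osc_tail qg gu tl); exact/agree_on_sym/agree_mix.
Qed.

Lemma pad_flip F i s : pad F (flip i s) = if i \in F then flip i (pad F s) else pad F s.
Proof.
apply/funext => j; rewrite /pad /mix /flip; case iF: (i \in F) => /=.
  by case: (eqVneq j i) => [->|//]; rewrite iF.
by case: (eqVneq j i) => [->|//]; rewrite iF.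
Qed.

Lemma osc_pad g u F : osc_le g u ->
  osc_le (fun s => g (pad F s)) (fun i => if i \in F then u i else 0).
Proof.
move=> gu i s; rewrite pad_flip; case: ifP => _; first exact: gu.
by rewrite subrr normr0.
Qed.

(** Two bounds compete: on [B] the truncation is uniformly [tau]-close, elsewhere neither term
    oscillates by more than [u i]. Fixing [B] first and then taking [tau] small relative to its size
    makes the total small. *)
Lemma osc_sub_pad g u F B (tau : R) : quasilocal g -> osc_le g u ->
  (B `<=` F)%fset -> tail_le u F tau ->
  osc_le (fun s => g s - g (pad F s)) (fun i => if i \in B then 2 * tau else 2 * u i).
Proof.
move=> qg gu /fsubsetP BF tl i s; have u0 := osc_le_ge0 gu i.
case: ifP => iB.
  have := pad_dist (flip i s) qg gu tl; have := pad_dist s qg gu tl.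
  by rewrite !ler_norml => /andP[? ?] /andP[? ?]; apply/andP; split; lra.
have h1 := gu i s; have h2 := osc_pad F gu i s.
have {h2} : `|g (pad F (flip i s)) - g (pad F s)| <= u i.
  by apply: le_trans h2 _; case: ifP.
by move: h1; rewrite !ler_norml => /andP[? ?] /andP[? ?]; apply/andP; split; lra.
Qed.

Lemma sum_osc_sub_pad u B G (tau tau' : R) : (forall i, 0 <= u i) -> 0 <= tau ->
  tail_le u B tau' ->
  \sum_(i <- G) (if i \in B then 2 * tau else 2 * u i) <=
  2 * ((size B)%:R * tau) + 2 * tau'.
Proof.
move=> u0 tau0 tl.
rewrite (bigID (mem B))/=; apply: lerD.
  apply: (@le_trans _ _ (\sum_(i <- G | i \in B) 2 * tau)).
    by rewrite le_eqVlt; apply/orP; left; apply/eqP; apply: eq_bigr => i ->.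
  rewrite -big_filter big_const_seq count_predT iter_addr_0 -[2 * tau *+ _]mulr_natr.
  rewrite -mulrA ler_pM2l// mulrC ler_wpM2r// ler_nat.
  apply: uniq_leq_size; first by rewrite filter_uniq.
  by move=> i; rewrite mem_filter => /andP[].
rewrite (eq_bigr (fun i => 2 * u i)) => [|i /negbTE ->//].
rewrite -mulr_sumr ler_pM2l//.
rewrite (_ : \sum_(i <- G | i \notin B) u i = \sum_(i <- (G `\` B)%fset) u i).
  by apply: tl => i; rewrite !inE => /andP[].
rewrite -big_filter; apply: perm_big; apply: uniq_perm => //.
  by rewrite filter_uniq.
by move=> i; rewrite mem_filter !inE.
Qed.

End Oscillation.

(** * The semigroup and its generator *)

Section MarkovSemigroup.
Variables (R : realType) (d : nat) (P : R -> R.-pker (config d) ~> (config d)).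
Implicit Types (s : config d) (f g h : config d -> R) (A : set (config d)).
Hypothesis HP : feller_transition P.

Notation S := (semigroup P).

Lemma semigroupE t f s : S t f s = Ex (P t s) f. Proof. by []. Qed.

Lemma pker_setT t s : P t s setT = 1%E. Proof. exact: prob_kernel. Qed.

Lemma semigroup_indic t A s : measurable A -> S t \1_A s = fine (P t s A).
Proof. by move=> mA; rewrite semigroupE Ex_indic. Qed.

Lemma pker_fin_num t s A : measurable A -> P t s A \is a fin_num.
Proof.
move=> mA; rewrite ge0_fin_numE// (@le_lt_trans _ _ 1%E) ?ltry//.
by rewrite -(pker_setT t s) le_measure// inE.
Qed.

Lemma semigroup_lin t a f g : bmeas f -> bmeas g ->
  S t (fun s => a * f s + g s) = fun s => a * S t f s + S t g s.
Proof.
move=> bf bg; apply/funext => s; rewrite !semigroupE.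
by rewrite (ExD (pker_setT t s))// ?(ExZ (pker_setT t s))//; exact: bmeasZ.
Qed.

Lemma semigroupB t f g s : bmeas f -> bmeas g ->
  S t (fun s' => f s' - g s') s = S t f s - S t g s.
Proof. by move=> bf bg; rewrite !semigroupE (ExB (pker_setT t s)). Qed.

Lemma semigroup_dist t f g (e : R) : bmeas f -> bmeas g ->
  (forall s, `|f s - g s| <= e) -> forall s, `|S t f s - S t g s| <= e.
Proof. by move=> bf bg fg s; exact: (Ex_dist_unif (pker_setT t s)). Qed.

Lemma semigroup_norm t f (M : R) : bmeas f ->
  (forall s, `|f s| <= M) -> forall s, `|S t f s| <= M.
Proof.
move=> bf fM s; rewrite semigroupE; apply: le_trans (Ex_norm (pker_setT t s) bf) _.
exact: (Ex_le_cst (pker_setT t s) (bmeas_norm bf)).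
Qed.

Lemma semigroup_bmeas t f : bmeas f -> bmeas (S t f).
Proof.
move: f; apply: bmeas_ind.
- move=> A mA; split; last first.
    exists 1 => s; apply: semigroup_norm; first exact: bmeas_indic.
    by move=> s'; rewrite indicE; case: (_ \in _); rewrite ?normr1 ?normr0.
  rewrite (_ : S t \1_A = fine \o (fun s => P t s A)).
    apply: measurableT_comp; first exact: fine_measurable.
    exact: measurable_kernel.
  by apply/funext => s /=; rewrite semigroup_indic.
- move=> a f g bf bg bSf bSg; rewrite semigroup_lin//.
  by apply: bmeasD => //; exact: bmeasZ.
- move=> f bf IH; apply: bmeas_ulim => e /IH[g [bg bSg fg]].
  by exists (S t g) => //; exact: semigroup_dist.
Qed.

Lemma semigroup0 f : bmeas f -> S 0 f = f.
Proof.
have [P0 _ _ _] := HP.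
move: f; apply: bmeas_ind.
- move=> A mA; apply/funext => s; by rewrite semigroup_indic// P0// diracE.
- by move=> a f g bf bg Sf Sg; rewrite semigroup_lin// Sf Sg.
- move=> f bf IH; apply/funext => s; apply: eq_approx => e /IH[g [bg Sg fg]].
  exists (g s); split; last exact: fg.
  by have := semigroup_dist 0 bf bg fg s; rewrite Sg.
Qed.

Lemma semigroupD t t' f : 0 <= t -> 0 <= t' -> bmeas f -> S (t + t') f = S t (S t' f).
Proof.
move=> t0 t'0; have [_ PD _ _] := HP.
move: f; apply: bmeas_ind.
- move=> A mA; apply/funext => s; rewrite semigroup_indic// PD//.
  rewrite /semigroup; congr fine; apply: eq_integral => s' _.
  by rewrite -/(semigroup P t' \1_A s') semigroup_indic// fineK// pker_fin_num.
- move=> a f g bf bg Sf Sg; rewrite !semigroup_lin//; [|exact: semigroup_bmeas..].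
  by rewrite Sf Sg.
- move=> f bf IH; apply/funext => s; apply: eq_approx => e /IH[g [bg Sg fg]].
  exists (S (t + t') g s); split; first exact: semigroup_dist.
  rewrite Sg; apply: semigroup_dist; [exact: semigroup_bmeas..|].
  exact: semigroup_dist.
Qed.

Section Invariance.
Variable m : {measure set (config d) -> \bar R}.
Hypothesis m1 : m setT = 1%E.

Let mP t A := (\int[m]_s P t s A)%E.

(** The measures $mP_t$ and $m$ agree on the sets decided by finitely many spins, a generating
    pi-system, hence on all events. *)
Lemma semigroup_invariant t : 0 <= t ->
  (forall f, local_fun f -> Ex m (S t f) = Ex m f) ->
  forall f, bmeas f -> Ex m (S t f) = Ex m f.
Proof.
move=> t0 Hloc.
have mfin A : measurable A -> m A \is a fin_num.
  move=> mA; rewrite ge0_fin_numE// (@le_lt_trans _ _ 1%E) ?ltry//.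
  by rewrite -m1 le_measure// inE.
have EA A : measurable A -> (mP t A = (Ex m (S t \1_A))%:E)%E.
  move=> mA; rewrite -(ExE m1); last exact/semigroup_bmeas/bmeas_indic.
  by apply: eq_integral => s _; rewrite semigroup_indic// fineK// pker_fin_num.
have HA A : measurable A -> mP t A = m A.
  rewrite (measurable_local_setsE R d); move: A.
  apply: (dynkin_induction (measurable_local_setsE R d)).
  - exact: local_setsI.
  - by rewrite /mP (eq_integral (cst 1%E)) ?integral_cst// ?mul1e// => s _; exact: pker_setT.
  - move=> A lA; have mA := local_sets_measurable R lA.
    by rewrite EA// Hloc ?Ex_indic ?fineK ?mfin//; exact: local_sets_indic.
  - move=> A mA IH.
    have EC : \1_(~` A) = (fun s => -1 * \1_A s + 1) :> (config d -> R).
      apply/funext => s; rewrite !indicE in_setC.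
      by case: (s \in A) => /=; ring.
    rewrite EA; last exact: measurableC.
    rewrite EC semigroup_lin//; [|exact: bmeas_indic|exact: bmeas_cst].
    have -> : m (~` A) = (Ex m \1_(~` A))%:E.
      by rewrite Ex_indic ?fineK ?mfin//; exact: measurableC.
    have bA := @bmeas_indic _ _ R A mA; have bSA := semigroup_bmeas t bA.
    have b1 := @bmeas_cst _ (config d) R 1; have bS1 := semigroup_bmeas t b1.
    rewrite EC (ExD m1)//; last exact: bmeasZ.
    rewrite (ExD m1)//; last exact: bmeasZ.
    rewrite !(ExZ m1)//.
    have -> : Ex m (S t \1_A) = Ex m \1_A.
      by move: IH; rewrite EA// -[m A]fineK ?mfin// -Ex_indic// => -[].
    have -> : S t (fun=> 1) = fun=> 1.
      by apply/funext => s; rewrite semigroupE (Ex_cst (pker_setT t s)).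
    by [].
  - move=> F mF tF IH; have mUF : measurable (\bigcup_k F k) by exact: bigcup_measurable.
    rewrite /mP measure_semi_bigcup// -(eq_eseriesr (fun n _ => IH n)).
    rewrite -integral_nneseries//; last by move=> n; exact: measurable_kernel.
    by apply: eq_integral => s _; rewrite measure_semi_bigcup.
apply: bmeas_ind.
- move=> A mA; apply: EFin_inj; rewrite -EA// HA// Ex_indic//.
  by rewrite fineK// mfin.
- move=> a f g bf bg If Ig; rewrite semigroup_lin//.
  have bSf := semigroup_bmeas t bf; have bSg := semigroup_bmeas t bg.
  rewrite (ExD m1)//; last exact: bmeasZ.
  rewrite (ExD m1)//; last exact: bmeasZ.
  by rewrite !(ExZ m1)// If Ig.
- move=> f bf IH; apply: eq_approx => e /IH[g [bg Ig fg]].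
  exists (Ex m g); split; last exact: Ex_dist_unif.
  rewrite -Ig; apply: Ex_dist_unif => //; [exact: semigroup_bmeas..|].
  exact: semigroup_dist.
Qed.

End Invariance.
End MarkovSemigroup.

(** * Approximation of the semigroup by discrete steps *)

Section GeneratorApproximation.
Variables (R : realType) (d : nat) (P : R -> R.-pker (config d) ~> (config d))
  (c p : site d -> config d -> R) (C : site d -> site d -> R) (q : R).
Implicit Types (i j : site d) (s : config d) (F B G : {fset site d})
  (f g h : config d -> R) (u w : site d -> R).
Hypothesis HP : feller_transition P.
Hypothesis HG : forall f, local_fun f -> generator_graph P f (spin_flip_generator c f).
Hypothesis cE : forall i f s, c i s * (f (flip i s) - f s) = resample p i f s - f s.
Hypothesis p01 : forall i s, 0 <= p i s <= 1.
Hypothesis pflip : forall i s, p i (flip i s) = p i s.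
Hypothesis pql : forall i, quasilocal (p i).
Hypothesis pC : forall i j s, `|p i (flip j s) - p i s| <= C i j.

Notation S := (semigroup P).

Definition gen F f s := \sum_(i <- F) (resample p i f s - f s).

Lemma near_at_right (Q : R -> Prop) : (\forall t \near 0^'+, Q t) ->
  exists2 r : R, 0 < r & forall t, 0 < t < r -> Q t.
Proof.
move=> [r r0 H]; exists r => // t /andP[t0 tr]; apply: H => //=.
by rewrite sub0r normrN gtr0_norm.
Qed.

Definition local_on F f := forall s s', agree_on F s s' -> f s = f s'.

Lemma spin_flip_generator_local F f s : local_on F f ->
  spin_flip_generator c f s = gen F f s.
Proof.
move=> fF; rewrite /spin_flip_generator /gen.
rewrite -(fsbig_widen [set` F])//= ?fsbig_finite//= ?set_fsetK.
  by apply: eq_bigr => i _; exact: cE.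
move=> i [_ /negP iF] /=; rewrite (fF (flip i s) s) ?subrr ?mulr0// => j jF.
by rewrite /flip; case: eqVneq => // ji; rewrite -ji jF in iF.
Qed.

Lemma gen_lin F (I : finType) (a : I -> R) (g : I -> config d -> R) s :
  gen F (fun s => \sum_k a k * g k s) s = \sum_k a k * gen F (g k) s.
Proof.
rewrite /gen; under [RHS]eq_bigr do rewrite mulr_sumr.
rewrite [RHS]exchange_big/=; apply: eq_bigr => i _.
rewrite /resample !mulr_sumr -big_split/= -sumrB.
by apply: eq_bigr => k _; ring.
Qed.

(* The functions local on [F] form a finite-dimensional space, so the generator
   limit is uniform over its bounded subsets. *)
Lemma local_generator F (M e : R) : 0 < e -> exists2 r : R, 0 < r &
  forall t f, 0 < t < r -> local_on F f -> (forall s, `|f s| <= M) ->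
  forall s, `|S t f s - f s - t * gen F f s| <= t * e.
Proof.
move=> e0; set K := #|{ffun F -> bool}|.
(* [K] counts the patterns on [F], and each coefficient in the cylinder basis is at most the
   absolute value of [M]; the [+ 1] keeps the denominator positive. *)
pose e' := e / (`|M| * K%:R + 1).
have K0 : 0 < `|M| * K%:R + 1 by rewrite ltr_wpDl// mulr_ge0.
have e'0 : 0 < e' by rewrite divr_gt0.
pose g (xi : {ffun F -> bool}) : config d -> R := \1_(cyl F (pattern xi)).
have gF xi : local_on F (g xi).
  move=> s s' h; rewrite /g !indicE !cyl_pattern; congr ((_ == _)%:R).
  by apply/ffunP => j; rewrite !ffunE h// fsvalP.
have near_xi xi : \forall t \near 0^'+, forall s,
    `|(S t (g xi) s - g xi s) / t - gen F (g xi) s| <= e'.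
  apply: filterS (HG (ex_intro _ F (gF xi)) e'0) => t h s.
  by rewrite -(spin_flip_generator_local _ (gF xi)).
have [r r0 Hr] := near_at_right (filter_forall _ near_xi).
exists r => // t f tr fF fM s; have /andP[t0 _] := tr.
have bg xi : bmeas (g xi) by apply/local_bmeas; exists F; exact: gF.
pose a (xi : {ffun F -> bool}) := f (pattern xi).
have fE : f = fun s => \sum_xi a xi * g xi s by exact: local_expansion.
have SfE : S t f s = \sum_xi a xi * S t (g xi) s.
  rewrite fE semigroupE (Ex_sum (pker_setT P t s)); last by move=> xi; exact: bmeasZ.
  by apply: eq_bigr => xi _; rewrite (ExZ (pker_setT P t s)).
have -> : S t f s - f s - t * gen F f s =
    t * \sum_xi a xi * ((S t (g xi) s - g xi s) / t - gen F (g xi) s).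
  rewrite SfE {1 2}fE gen_lin mulr_sumr -!sumrB mulr_sumr; apply: eq_bigr => xi _.
  by field; rewrite gt_eqF.
rewrite normrM (gtr0_norm t0) ler_pM2l//.
apply: (@le_trans _ _ (\sum_(xi : {ffun F -> bool}) `|M| * e')).
  rewrite (le_trans (ler_norm_sum _ _ _))// ler_sum// => xi _; rewrite normrM.
  apply: ler_pM => //; last exact: Hr.
  by rewrite (le_trans (fM _))// ler_norm.
rewrite sumr_const -/K -[leLHS]mulr_natr mulrAC /e' mulrA ler_pdivrMr//.
rewrite mulrC ler_pM2l// lerDl//.
Qed.

Lemma semigroup_lip_iter (t V : R) f n : 0 <= t -> bmeas f ->
  (forall s, `|S t f s - f s| <= V) -> forall s, `|S (n%:R * t) f s - f s| <= n%:R * V.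
Proof.
move=> t0 bf fV; elim: n => [|n IH] s.
  by rewrite !mul0r (semigroup0 HP)// subrr normr0.
have nt0 : 0 <= n%:R * t by rewrite mulr_ge0.
have -> : n.+1%:R * t = n%:R * t + t by rewrite -natr1; ring.
rewrite (semigroupD HP)//.
have h1 := semigroup_dist P (n%:R * t) (semigroup_bmeas P t bf) bf fV s.
apply: le_trans (ler_distD (S (n%:R * t) f s) _ _) _.
by rewrite -natr1 mulrDl mul1r addrC lerD.
Qed.

Lemma gen_bound F f u s : osc_le f u -> `|gen F f s| <= \sum_(i <- F) u i.
Proof.
move=> fu; rewrite /gen (le_trans (ler_norm_sum _ _ _))// ler_sum// => i _.
have /andP[p0 p1] := p01 i s; have p1' : 0 <= 1 - p i s by rewrite subr_ge0.
have -> : resample p i f s - f s = p i s * (f (set_spin i true s) - f s) +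
   (1 - p i s) * (f (set_spin i false s) - f s) by rewrite /resample; ring.
rewrite (le_trans (ler_normD _ _))// !normrM (ger0_norm p0) (ger0_norm p1').
have -> : u i = p i s * u i + (1 - p i s) * u i by ring.
by apply: lerD; apply: ler_wpM2l => //; exact: osc_set_spin.
Qed.

(** The generator of [f] is bounded by the total oscillation [V]. Short times follow from the
    generator limit, longer ones by cutting [[0, t]] into short pieces and using contractivity. *)
Lemma semigroup_lip_local F f u (V t : R) : local_on F f -> osc_le f u ->
  \sum_(i <- F) u i <= V -> 0 <= t -> forall s, `|S t f s - f s| <= t * V.
Proof.
move=> fF fu uV t0 s.
have lf : local_fun f by exists F.
have bf := local_bmeas lf; have [_ [M fM]] := bf.
have [->|tn0] := eqVneq t 0; first by rewrite (semigroup0 HP)// subrr normr0 mul0r.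
have tp : 0 < t by rewrite lt_def tn0.
apply/ler_addgt0Pr => e e0.
(* An error rate [e / t] accumulates to [e] over the whole time [t]. *)
have et0 : 0 < e / t by rewrite divr_gt0.
have [r r0 Hr] := local_generator F M et0.
pose n := (Num.truncn (t / r)).+1.
have n0 : 0 < n%:R :> R by rewrite ltr0n.
have tnr : t / n%:R < r.
  by rewrite ltr_pdivrMr// mulrC -ltr_pdivrMr// /n truncnS_gt.
have tn : 0 < t / n%:R < r by rewrite divr_gt0.
have h s' : `|S (t / n%:R) f s' - f s'| <= t / n%:R * (V + e / t).
  have h1 := Hr _ _ tn fF fM s'; have h2 := gen_bound F s' fu.
  have tn0' : 0 <= t / n%:R by have /andP[/ltW] := tn.
  rewrite -(subrK (t / n%:R * gen F f s') (_ - f s')).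
  rewrite (le_trans (ler_normD _ _))// mulrDr addrC lerD//.
  by rewrite normrM (ger0_norm tn0') ler_wpM2l// (le_trans h2).
have := semigroup_lip_iter n (ltW (divr_gt0 tp n0)) bf h s.
have -> : n%:R * (t / n%:R) = t by field; rewrite gt_eqF.
move=> /le_trans; apply; rewrite mulrA.
have -> : n%:R * (t / n%:R) = t by field; rewrite gt_eqF.
by rewrite mulrDr [t * (e / t)]mulrC divfK.
Qed.

Lemma semigroup_lip f u (V t : R) : quasilocal f -> osc_le f u ->
  (forall F, \sum_(i <- F) u i <= V) -> 0 <= t -> forall s, `|S t f s - f s| <= t * V.
Proof.
move=> qf fu uV t0 s; apply/ler_addgt0Pr => e e0.
have e20 : 0 < e / 2 by rewrite divr_gt0.
have [F hF] := qf _ e20.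
pose fF s := f (pad F s).
have ffF s' : `|f s' - fF s'| <= e / 2 by apply/hF/agree_on_sym/agree_mix.
have bf := quasilocal_bmeas qf.
have bfF : bmeas fF by apply/local_bmeas/local_pad.
have h : `|S t fF s - fF s| <= t * V.
  apply: (semigroup_lip_local (F := F)) (osc_pad F fu) _ t0 s.
    by move=> s1 s2 /pad_agree; rewrite /fF => ->.
  apply: le_trans (uV F); rewrite big_seq [leRHS]big_seq.
  by apply: ler_sum => i ->.
have := semigroup_dist P t bf bfF ffF s; have := ffF s; move: h.
by rewrite !ler_norml => /andP[? ?] /andP[? ?] /andP[? ?]; apply/andP; split; lra.
Qed.

Lemma genB F f g s : gen F (fun s => f s - g s) s = gen F f s - gen F g s.
Proof. by rewrite /gen -sumrB; apply: eq_bigr => i _; rewrite /resample; ring. Qed.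

(** The threshold [r] does not depend on [f], as telescoping over iterates demands. The truncation
    of [f] to [F] is covered by finite-dimensional uniformity; the remainder has so little total
    oscillation that neither semigroup nor generator moves it much. *)
Lemma step_semigroup_close w (M e : R) : (forall i, 0 <= w i) ->
  (\esum_(i in [set: site d]) (w i)%:E < +oo)%E -> 0 < e ->
  exists F0, forall F, (F0 `<=` F)%fset -> exists2 r : R, 0 < r &
  forall t f, 0 <= t < r -> quasilocal f -> (forall s, `|f s| <= M) -> osc_le f w ->
  forall s, `|S t f s - step p F t f s| <= t * e.
Proof.
move=> w0 woo e0.
(* The remainder has total oscillation at most $2|B|\tau + 2e/12 \le e/3$. The three errors, from
   the semigroup and the generator on the remainder and from the truncation, are then [t * (e / 3)]
   each. *)
have e80 : 0 < e / 12 by rewrite divr_gt0.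
have [B tlB] := summable_tail w0 woo e80.
pose tau := e / 12 / ((size B)%:R + 1).
have sB0 : 0 < (size B)%:R + 1 :> R by rewrite ltr_wpDl.
have tau0 : 0 < tau by rewrite divr_gt0.
have [A tlA] := summable_tail w0 woo tau0.
exists (A `|` B)%fset => F ABF.
have AF : (A `<=` F)%fset by apply: fsubset_trans ABF; exact: fsubsetUl.
have BF : (B `<=` F)%fset by apply: fsubset_trans ABF; exact: fsubsetUr.
have tlF := tail_leS AF tlA.
have e30 : 0 < e / 3 by rewrite divr_gt0.
have [r r0 Hr] := local_generator F M e30.
exists r => // t f /andP[t0 tr] qf fM fw s.
have bf := quasilocal_bmeas qf.
have [->|tn0] := eqVneq t 0.
  by rewrite (semigroup0 HP)// /step !mul0r addr0 subrr normr0.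
have tp : 0 < t by rewrite lt_def tn0.
pose fF s := f (pad F s).
have lfF : local_on F fF by move=> s1 s2 /pad_agree; rewrite /fF => ->.
have bfF : bmeas fF by apply/local_bmeas/local_pad.
pose h s := f s - fF s.
have qh : quasilocal h.
  by apply: quasilocalB => //; apply: local_quasilocal; exact: local_pad.
have ho : osc_le h (fun i => if i \in B then 2 * tau else 2 * w i).
  exact: osc_sub_pad.
have hV G : \sum_(i <- G) (if i \in B then 2 * tau else 2 * w i) <= e / 3.
  apply: le_trans (sum_osc_sub_pad G w0 (ltW tau0) tlB) _.
  have : (size B)%:R * tau <= e / 12.
    rewrite /tau mulrCA -[leRHS]mulr1 ler_pM2l// ler_pdivrMr// mul1r.
    by rewrite lerDl.
  by lra.
have h1 := semigroup_lip qh ho hV t0 s.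
have h2 : `|S t fF s - fF s - t * gen F fF s| <= t * (e / 3).
  by apply: Hr => //; [rewrite tp tr|move=> s'; exact: fM].
have h3 : `|t * gen F h s| <= t * (e / 3).
  by rewrite normrM (ger0_norm t0) ler_wpM2l// (le_trans (gen_bound F s ho)).
move: h1 h3; rewrite semigroupB// genB /h /step -/(gen F f s) => h1 h3.
move: h1 h2 h3; rewrite !ler_norml => /andP[? ?] /andP[? ?] /andP[? ?].
by apply/andP; split; lra.
Qed.

Hypothesis q01 : 0 < q < 1.
Hypothesis Crow : forall F i, \sum_(j <- F) C i j <= q.

Lemma expR_pow_ub (t : R) m : 0 <= t -> (1 + t / m%:R) ^+ m <= expR t.
Proof.
move=> t0; have [->|m0] := eqVneq m 0%N; first by rewrite expr0 -expR0 ler_expR.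
have E : m%:R * (t / m%:R) = t by rewrite mulrC divfK// pnatr_eq0.
rewrite -[X in _ <= expR X]E expRM_natl lerXn2r// ?nnegrE ?expR_ge0 ?expR_ge1Dx//.
by rewrite addr_ge0// divr_ge0.
Qed.

(** The second condition makes [step] a convex combination; the first serves the contraction of the
    oscillations. *)
Definition fine_mesh F (t : R) m :=
  [/\ 0 <= t / m%:R <= 1, t / m%:R * (size F)%:R <= 1 & (0 < m)%N].

Lemma fine_mesh_eventually F (t : R) : 0 <= t ->
  exists m0, forall m, (m0 <= m)%N -> fine_mesh F t m.
Proof.
move=> t0; exists (Num.truncn (t * ((size F)%:R + 1))).+1 => m hm.
have m0 : (0 < m)%N by apply: leq_trans hm.
have mp : 0 < m%:R :> R by rewrite ltr0n.
have h : t * ((size F)%:R + 1) <= m%:R.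
  by rewrite (le_trans (ltW (truncnS_gt _)))// ler_nat.
have hF : 0 <= t * (size F)%:R by rewrite mulr_ge0.
split => //.
- by rewrite divr_ge0//= ler_pdivrMr// mul1r; lra.
- by rewrite mulrAC ler_pdivrMr// mul1r; lra.
Qed.

(* Telescoping [S_t f - step^m f] over the [m] steps: the one-step errors are
   uniformly [o(t/m)] because all iterates obey the same oscillation bound. *)
Lemma step_approx f u (t M : R) : quasilocal f -> (forall s, `|f s| <= M) ->
  osc_le f u -> (\esum_(i in [set: site d]) (u i)%:E < +oo)%E -> 0 <= t ->
  forall e : R, 0 < e -> exists F0, forall F, (F0 `<=` F)%fset -> exists m0,
  forall m, (m0 <= m)%N ->
  forall s, `|S t f s - iter m (step p F (t / m%:R)) f s| <= e.
Proof.
move=> qf fM fu uoo t0 e e0.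
have u0 := osc_le_ge0 fu.
have [w [uw Cw woo]] := superharmonic_majorant (C_ge0 pC) q01 Crow u0 uoo.
have w0 i : 0 <= w i by have /andP[h1 h2] := uw i; exact: le_trans h2.
(* As $(1 + t/m)^k \le e^t$ for $k \le m$, this one summable vector bounds the oscillations of every
   iterate. *)
pose w' i := expR t * w i.
have w'0 i : 0 <= w' i by rewrite mulr_ge0 ?expR_ge0.
have w'oo : (\esum_(i in [set: site d]) (w' i)%:E < +oo)%E.
  apply: (@le_lt_trans _ _ ((expR t)%:E * (\esum_(i in [set: site d]) (w i)%:E))%E).
    apply: (@esum_scale_le R _ (expR t) (fun i => (w i)%:E)); first exact: expR_ge0.
    by move=> i; rewrite lee_fin.
  by rewrite lte_mul_pinfty// ?lee_fin ?expR_ge0.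
have et0 : 0 < e / (t + 1) by rewrite divr_gt0// ltr_wpDl.
have [F0 HF0] := step_semigroup_close M w'0 w'oo et0.
exists F0 => F /HF0[r r0 Hr].
have [m1 Hm1] := fine_mesh_eventually F t0.
exists (maxn m1 (Num.truncn (t / r)).+1) => m; rewrite geq_max => /andP[/Hm1 + mr].
move=> [e01 eF m0]; have mp : 0 < m%:R :> R by rewrite ltr0n.
have tm0 : 0 <= t / m%:R by have /andP[] := e01.
have tmr : 0 <= t / m%:R < r.
  rewrite tm0 ltr_pdivrMr// mulrC -ltr_pdivrMr//.
  by rewrite (lt_le_trans (truncnS_gt _))// ler_nat.
set dt := t / m%:R in e01 eF tm0 tmr *.
have bf := quasilocal_bmeas qf.
suff H k s : (k <= m)%N ->
    `|S (k%:R * dt) f s - iter k (step p F dt) f s| <= k%:R * (dt * (e / (t + 1))).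
  move=> s; have := H m s (leqnn m).
  have mt : m%:R * dt = t by rewrite /dt mulrC divfK// gt_eqF.
  rewrite mulrA !mt => /le_trans; apply.
  by rewrite mulrA ler_pdivrMr ?ltr_wpDl//; lra.
elim: k s => [|k IH] s km.
  by rewrite !mul0r (semigroup0 HP)// subrr normr0.
have kdt : 0 <= k%:R * dt by rewrite mulr_ge0.
have -> : k.+1%:R * dt = dt + k%:R * dt by rewrite -natr1; ring.
rewrite (semigroupD HP)// iterS.
have qk := iter_step_quasilocal pql F dt k qf.
have bk := quasilocal_bmeas qk.
have ok : osc_le (iter k (step p F dt) f) w'.
  move=> i s'; apply: le_trans (iter_step_osc p01 pflip pC k tm0 eF fu i s') _.
  apply: le_trans (iter_vstep_dom pC k tm0 eF uw Cw i) _.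
  rewrite ler_wpM2r//; apply: le_trans (expR_pow_ub m t0).
  by rewrite -/dt ler_weXn2l ?lerDl// ltnW.
have Mk := iter_step_bound p01 k tm0 eF fM.
have h1 := semigroup_dist P dt (semigroup_bmeas P (k%:R * dt) bf) bk
  (fun s => IH s (ltnW km)) s.
have h2 := Hr dt _ tmr qk Mk ok s.
apply: le_trans (ler_distD (S dt (iter k (step p F dt) f) s) _ _) _.
by rewrite -natr1 mulrDl mul1r lerD.
Qed.

End GeneratorApproximation.

(** * Concentration *)

Section DLR.
Variables (R : realType) (d : nat) (U : {fset site d} -> config d -> R)
  (mu : probability (config d) R).
Hypothesis HU : translation_invariant_interaction U.
Hypothesis Hmu : gibbs_measure U mu.

Lemma site_cond_bmeas i v : bmeas (site_cond U i v).
Proof.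
have bt := quasilocal_bmeas (site_cond_quasilocal HU i).
case: v => //.
rewrite (_ : site_cond U i false = fun s => 1 - site_cond U i true s).
  by apply: bmeasB => //; exact: bmeas_cst.
by apply/funext => s; rewrite -(site_cond_sum U i s) addrC addKr.
Qed.

(** The DLR equation at [i] is tested on the event that [A] holds once the spin at [i] is set to
    [v]. This event is measurable outside [i] and meets [s i = v] in the same set as [A]. *)
Lemma gibbs_site i v (A : set (config d)) : measurable A ->
  Ex mu (fun s => site_cond U i v s * \1_A (set_spin i v s)) =
  fine (mu (A `&` [set s | s i = v])).
Proof.
move=> mA; have oA := @set_spin_outside _ i v _ mA.
have mAv := outside_measurable oA.
have [g [mg ig Hg] gE] := Hmu [ffun _ : [fset i]%fset => v].
have setE : [set s : config d | config_restr [fset i]%fset s = [ffun=> v]] =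
    [set s | s i = v].
  apply/seteqP; split => s /= h.
    by have /ffunP/(_ [` fset11 i]%fset) := h; rewrite !ffunE.
  apply/ffunP => j; rewrite !ffunE.
  by rewrite -h; congr (s _); have := fsvalP j; rewrite inE => /eqP.
have -> : A `&` [set s | s i = v] = [set s | s i = v] `&` (set_spin i v @^-1` A).
  apply/seteqP; split => s /= [h1 h2].
    by split => //; rewrite set_spinE h2 eqxx.
  by split => //; move: h2; rewrite set_spinE h1 eqxx.
rewrite -setE -Hg//; congr fine.
have bs := site_cond_bmeas i v.
transitivity (\int[mu]_(s in set_spin i v @^-1` A) (site_cond U i v s)%:E)%E.
  rewrite [RHS]integral_mkcond; apply: eq_integral => s _.
  rewrite patchE indicE; have -> : (s \in set_spin i v @^-1` A) = (set_spin i v s \in A).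
    by apply/idP/idP; rewrite !inE.
  by case: ifP => _ /=; rewrite ?mulr1 ?mulr0.
apply: ae_eq_integral => //.
- apply/measurable_EFinP; exact: measurable_funS bs.1.
- have /measurable_EFinP := measurable_int _ ig.
  by move=> h; apply/measurable_EFinP; exact: measurable_funS h.
- by apply: filterS gE => s gs _; rewrite gs.
Qed.

Lemma gibbs_resample i f : bmeas f ->
  Ex mu (resample (fun i => site_cond U i true) i f) = Ex mu f.
Proof.
have m1 : mu setT = 1%E := probability_setT mu.
have HU' := site_cond_bmeas.
have p01 j s : 0 <= site_cond U j true s <= 1 by rewrite site_cond_ge0 site_cond_le1.
have br g : bmeas g -> bmeas (resample (fun i => site_cond U i true) i g).
  by apply: resample_bmeas => j; exact: site_cond_quasilocal.
move: f; apply: bmeas_ind.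
- move=> A mA.
  have -> : resample (fun i => site_cond U i true) i \1_A = fun s =>
      site_cond U i true s * \1_A (set_spin i true s) +
      site_cond U i false s * \1_A (set_spin i false s).
    apply/funext => s; rewrite /resample; congr (_ + _ * _).
    by rewrite -(site_cond_sum U i s) addrC addKr.
  have bI v : bmeas (fun s => site_cond U i v s * \1_A (set_spin i v s)).
    apply: bmeasM => //; exact: (bmeas_set_spin i v (bmeas_indic mA)).
  rewrite (ExD m1)// !gibbs_site// Ex_indic//.
  have mv v : measurable [set s : config d | s i = v].
    case: v; first exact: measurable_coord.
    have -> : [set s : config d | s i = false] = ~` [set s : config d | s i].
      by apply/seteqP; split => s /=; [move=> ->|move/negP/negbTE].
    by apply: measurableC; exact: measurable_coord.
  have fin v : mu (A `&` [set s : config d | s i = v]) \is a fin_num.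
    by rewrite fin_num_measure//; exact: measurableI.
  rewrite -fineD// -measureU//; try exact: measurableI.
    congr (fine (mu _)); apply/seteqP; split => s /=; first by case=> -[].
    by case si: (s i) => As; [left|right].
  apply/seteqP; split => s //= [[_ h1] [_ h2]].
  by rewrite h1 in h2.
- move=> a f g bf bg If Ig.
  have -> : resample (fun i => site_cond U i true) i (fun s => a * f s + g s) =
     fun s => a * resample (fun i => site_cond U i true) i f s +
       resample (fun i => site_cond U i true) i g s.
    by apply/funext => s; rewrite /resample; ring.
  have rf := br f bf; have rg := br g bg; have arf := bmeasZ a rf.
  have af := bmeasZ a bf.
  by rewrite (ExD m1 arf rg) (ExD m1 af bg) (ExZ m1 a rf) (ExZ m1 a bf) If Ig.
- move=> f bf IH; apply: eq_approx => e /IH[g [bg Ig fg]].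
  exists (Ex mu g); split; last exact: Ex_dist_unif.
  rewrite -Ig; apply: Ex_dist_unif => //; [exact: br..|] => s.
  have -> : resample (fun i => site_cond U i true) i f s -
     resample (fun i => site_cond U i true) i g s =
     resample (fun i => site_cond U i true) i (fun s => f s - g s) s.
    by rewrite /resample; ring.
  apply: le_trans (resample_norm p01 _ _ _) _.
  rewrite -[leRHS](resample_cst (fun i => site_cond U i true) i e s).
  exact: resample_le.
Qed.

End DLR.

(** * Mixing and the exponential moment bound *)

Section Concentration.
Variables (R : realType) (d : nat) (P : R -> R.-pker (config d) ~> (config d))
  (c p : site d -> config d -> R) (C : site d -> site d -> R) (q : R)
  (m : {measure set (config d) -> \bar R}).
Implicit Types (i j : site d) (s : config d) (F B G : {fset site d})
  (f g h : config d -> R) (u w : site d -> R).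
Hypothesis HP : feller_transition P.
Hypothesis HG : forall f, local_fun f -> generator_graph P f (spin_flip_generator c f).
Hypothesis cE : forall i f s, c i s * (f (flip i s) - f s) = resample p i f s - f s.
Hypothesis p01 : forall i s, 0 <= p i s <= 1.
Hypothesis pflip : forall i s, p i (flip i s) = p i s.
Hypothesis pql : forall i, quasilocal (p i).
Hypothesis pC : forall i j s, `|p i (flip j s) - p i s| <= C i j.
Hypothesis q01 : 0 < q < 1.
Hypothesis Crow : forall F i, \sum_(j <- F) C i j <= q.
Hypothesis Ccol : forall F j, \sum_(i <- F) C i j <= q.
Hypothesis m1 : m setT = 1%E.
Hypothesis inv : forall i f, bmeas f -> Ex m (resample p i f) = Ex m f.

Notation S := (semigroup P).

Lemma local_osc F f : local_on F f -> exists u : site d -> R,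
  [/\ osc_le f u, forall i, i \notin F -> u i = 0 &
      (\esum_(i in [set: site d]) (u i)%:E < +oo)%E].
Proof.
move=> fF; have [_ [M fM]] : bmeas f by apply: local_bmeas; exists F.
have M0 : 0 <= M := le_trans (normr_ge0 _) (fM (fun=> false)).
pose u i := if i \in F then 2 * M else 0.
have u0 i : 0 <= u i by rewrite /u; case: ifP => // _; rewrite mulr_ge0.
exists u; split.
- move=> i s; rewrite /u; case: ifPn => iF.
    by rewrite (le_trans (ler_normB _ _))// mulr2n mulrDl mul1r lerD.
  rewrite (fF (flip i s) s) ?subrr ?normr0// => j jF; rewrite /flip.
  by case: eqVneq => // ji; rewrite ji (negbTE iF) in jF.
- by move=> i /negbTE iF; rewrite /u iF.
- rewrite (esumID [set` F]); last by move=> i _; rewrite lee_fin.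
  rewrite [X in (_ + X)%E]esum1 ?adde0; last first.
    by move=> i [_ /negP /negbTE iF]; rewrite /u iF.
  rewrite setTI esum_fset//; last by move=> i _; rewrite lee_fin.
  by rewrite fsbig_finite//= sumEFin ltry.
Qed.

Lemma local_approx f (t : R) : local_fun f -> 0 <= t -> forall e : R, 0 < e ->
  exists F0, forall F, (F0 `<=` F)%fset -> exists m0, forall n, (m0 <= n)%N ->
  forall s, `|S t f s - iter n (step p F (t / n%:R)) f s| <= e.
Proof.
move=> lf t0 e e0; have [A fA] := lf.
have [u [fu _ uoo]] := local_osc fA; have [_ [M fM]] := local_bmeas lf.
exact: (step_approx HP HG cE p01 pflip pql pC q01 Crow (local_quasilocal lf) fM fu uoo t0 e0).
Qed.

(** On local functions [S t] is a uniform limit of iterates of [step], all of which preserve [m]. *)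
Lemma stationary t f : 0 <= t -> bmeas f -> Ex m (S t f) = Ex m f.
Proof.
move=> t0; apply: semigroup_invariant => // {}f lf.
have bf := local_bmeas lf; have bSf := semigroup_bmeas P t bf.
apply: eq_approx => e e0; exists (Ex m f); rewrite subrr normr0 (ltW e0); split => //.
have [F0 /(_ F0 (fsubset_refl _))[m0 /(_ m0 (leqnn _)) H]] := local_approx lf t0 e0.
have bK := iter_step_bmeas pql F0 (t / m0%:R) m0 bf.
by have := Ex_dist_unif m1 bSf bK H; rewrite (Ex_iter_step m1 pql inv).
Qed.

Lemma semigroup_contract t f g : 0 <= t -> bmeas f -> bmeas g ->
  Ex m (fun s => `|S t f s - S t g s|) <= Ex m (fun s => `|f s - g s|).
Proof.
move=> t0 bf bg; have bD := bmeasB bf bg; have bN := bmeas_norm bD.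
rewrite -(stationary t0 bN); apply: le_Ex => // [||s].
- by apply/bmeas_norm/bmeasB; exact: semigroup_bmeas.
- exact: semigroup_bmeas.
- by rewrite -semigroupB// semigroupE; exact: (Ex_norm (pker_setT P t s)).
Qed.

(** A local [h] close to [f] in $L^1(m)$ stays close under both evolutions, since both contract;
    uniform convergence is needed for [h] alone. *)
Lemma step_approx_L1 f (t : R) : bmeas f -> 0 <= t -> forall e : R, 0 < e ->
  exists F0, forall F, (F0 `<=` F)%fset -> exists m0, forall n, (m0 <= n)%N ->
  Ex m (fun s => `|iter n (step p F (t / n%:R)) f s - S t f s|) <= e.
Proof.
move=> bf t0 e e0; have e30 : 0 < e / 3 by rewrite divr_gt0.
have [h lh fh] := local_dense m1 bf e30; have bh := local_bmeas lh.
have [F0 HF0] := local_approx lh t0 e30.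
exists F0 => F /HF0[m0 Hm0]; have [m2 Hm2] := fine_mesh_eventually F t0.
exists (maxn m0 m2) => n; rewrite geq_max => /andP[/Hm0 Hn /Hm2[/andP[n0 _] nF _]].
have bSf := semigroup_bmeas P t bf; have bSh := semigroup_bmeas P t bh.
have bKf := iter_step_bmeas pql F (t / n%:R) n bf.
have bKh := iter_step_bmeas pql F (t / n%:R) n bh.
apply: le_trans (Ex_dist_tri m1 bKf bKh bSf) _.
have h1 := iter_step_contract m1 p01 pql inv n n0 nF bf bh.
have h2 := Ex_dist_tri m1 bKh bSh bSf.
have h3 : Ex m (fun s => `|iter n (step p F (t / n%:R)) h s - S t h s|) <= e / 3.
  apply: Ex_le_cst => // [|s]; first exact/bmeas_norm/bmeasB.
  by rewrite distrC.
have h4 := semigroup_contract t0 bh bf.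
have h5 : Ex m (fun s => `|h s - f s|) = Ex m (fun s => `|f s - h s|).
  by congr (Ex m _); apply/funext => s; rewrite distrC.
have -> : e = e / 3 + (e / 3 + e / 3) by field.
rewrite h5 in h4.
exact: lerD (le_trans h1 fh) (le_trans h2 (lerD h3 (le_trans h4 fh))).
Qed.

Lemma rate_pow (t : R) F n : fine_mesh F t n ->
  (1 - t / n%:R * (1 - q)) ^+ n <= expR (- (1 - q) * t).
Proof.
move=> [e01 _ n0].
have -> : - (1 - q) * t = n%:R * (- (t / n%:R * (1 - q))).
  by field; rewrite pnatr_eq0 -lt0n.
rewrite expRM_natl lerXn2r// ?nnegrE ?expR_ge0 ?expR_ge1Dx//.
exact: (rate_ge0 q01).
Qed.

(** Two arbitrary configurations differ by at most the total oscillation of the approximating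
    iterate. Inside [F] that total decays exponentially; outside [F] it is bounded by a tail of the
    majorant [w]. *)
Lemma local_mixing h : local_fun h -> forall e : R, 0 < e ->
  exists2 T : R, 0 <= T & forall s s', `|S T h s - S T h s'| <= e.
Proof.
move=> lh e e0; have [A hA] := lh; have [_ q1] := andP q01.
have [u [hu uA uoo]] := local_osc hA; have u0 := osc_le_ge0 hu.
have bh := local_bmeas lh; have qh := local_quasilocal lh.
have e40 : 0 < e / 4 by rewrite divr_gt0.
have k0 : 0 < 1 - q by rewrite subr_gt0.
pose W := \sum_(i <- A) u i.
have W0 : 0 <= W by apply: sumr_ge0.
(* Chosen so that $(1-q)T = x$ with $x = W/(e/4)$; then $x \le e^x$ is the required decay. *)
pose T := W / (e / 4) / (1 - q).
have T0 : 0 <= T by rewrite divr_ge0 ?(ltW k0)// divr_ge0// ltW.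
have decay : expR (- (1 - q) * T) * W <= e / 4.
  have -> : - (1 - q) * T = - (W / (e / 4)) by rewrite /T; field; rewrite !gt_eqF.
  rewrite expRN mulrC ler_pdivrMr ?expR_gt0// mulrC.
  rewrite -ler_pdivrMr// (le_trans _ (expR_ge1Dx _))// lerDr//.
exists T => // s s'.
have [w [uw Cw woo]] := superharmonic_majorant (C_ge0 pC) q01 Crow u0 uoo.
have w0 i : 0 <= w i by have /andP[h1 h2] := uw i; exact: le_trans h2.
(* [T] is fixed before the window: outside [F] oscillations may have grown by $e^T$, and the tail of
   [w] must beat this factor. *)
have e4T : 0 < e / 4 / expR T by rewrite divr_gt0// expR_gt0.
have [B tlB] := summable_tail w0 woo e4T.
have [F0 HF0] := local_approx lh T0 e40.
pose F := (F0 `|` (A `|` B))%fset.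
have AF : (A `<=` F)%fset.
  by apply: fsubset_trans (fsubsetUr _ _); exact: fsubsetUl.
have BF : (B `<=` F)%fset.
  by apply: fsubset_trans (fsubsetUr _ _); exact: fsubsetUr.
have [m0 Hm0] := HF0 F (fsubsetUl _ _).
have [m2 Hm2] := fine_mesh_eventually F T0.
pose n := maxn m0 m2.
have Hn := Hm0 n (leq_maxl _ _); have fm := Hm2 n (leq_maxr _ _).
have [n01 nF n0] := fm; have /andP[n0' n1] := n01.
set g := iter n (step p F (T / n%:R)) h in Hn.
have qg : quasilocal g by exact: iter_step_quasilocal.
have og : osc_le g (iter n (vstep C F (T / n%:R)) u) by exact: iter_step_osc.
suff hg : `|g s - g s'| <= e / 2.
  have := Hn s; have := Hn s'; move: hg.
  by rewrite !ler_norml => /andP[? ?] /andP[? ?] /andP[? ?]; apply/andP; split; lra.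
(* Agreement on the empty set is no constraint, so [s] and [s'] remain arbitrary. *)
apply: (osc_tail (A := fset0) qg og); last by move=> i; rewrite inE.
move=> G _; set v := iter n _ u.
have v0 i : 0 <= v i by apply: iter_vstep_ge0.
apply: (@le_trans _ _ (\sum_(i <- F) v i + \sum_(i <- (G `\` F)%fset) v i)).
  rewrite (bigID (mem F))/=; apply: lerD; rewrite -big_filter.
    rewrite (perm_big (enum_fset (G `&` F)%fset)) /=; last first.
      by apply: uniq_perm; rewrite ?filter_uniq// => i; rewrite mem_filter !inE andbC.
    rewrite [leRHS](big_fsetID _ (mem G))/=.
    rewrite (_ : [fset x | x in F & x \in G]%fset = (G `&` F)%fset).
      by rewrite lerDl sumr_ge0.
    by apply/fsetP => i; rewrite !inE/= andbC.
  rewrite (perm_big (enum_fset (G `\` F)%fset)) //=.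
  by apply: uniq_perm; rewrite ?filter_uniq// => i; rewrite mem_filter !inE.
have -> : e / 2 = e / 4 + e / 4 by field.
apply: lerD.
  apply: le_trans (iter_vstep_l1 pC q01 Crow n n01 nF u0) _.
  apply: le_trans decay; rewrite (_ : \sum_(i <- F) u i = W).
    by rewrite ler_wpM2r// (rate_pow fm).
  rewrite (big_fsetID _ (mem A))/= [X in _ + X]big1_fset ?addr0.
    rewrite (_ : [fset x | x in F & x \in A]%fset = A)//.
    apply/fsetP => i; rewrite !inE/=; case iA: (i \in A); rewrite ?andbF// andbT.
    by rewrite /= orbT.
  by move=> i; rewrite !inE/= => /andP[_ /uA].
have vw i : v i <= expR T * w i.
  apply: le_trans (iter_vstep_dom pC n n0' nF uw Cw i) _.
  by rewrite ler_wpM2r// expR_pow_ub.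
apply: (@le_trans _ _ (\sum_(i <- (G `\` F)%fset) expR T * w i)); first exact: ler_sum.
rewrite -mulr_sumr mulrC -ler_pdivlMr ?expR_gt0//; apply: tlB => i.
by rewrite in_fsetD => /andP[+ _]; apply: contra; exact: (fsubsetP BF).
Qed.

Lemma mixing g : bmeas g -> forall e : R, 0 < e ->
  exists2 T : R, 0 <= T & Ex m (fun s => `|S T g s - Ex m g|) <= e.
Proof.
move=> bg e e0; have e30 : 0 < e / 3 by rewrite divr_gt0.
have [h lh gh] := local_dense m1 bg e30; have bh := local_bmeas lh.
have [T T0 HT] := local_mixing lh e30; exists T => //.
have bSg := semigroup_bmeas P T bg; have bSh := semigroup_bmeas P T bh.
have bc a := @bmeas_cst _ (config d) R a.
apply: le_trans (Ex_dist_tri m1 bSg bSh (bc _)) _.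
have h1 := semigroup_contract T0 bg bh.
have h2 := Ex_dist_tri m1 bSh (bc (Ex m h)) (bc (Ex m g)).
have h3 : Ex m (fun s => `|S T h s - Ex m h|) <= e / 3.
  apply: Ex_le_cst => // [|s]; first exact/bmeas_norm/bmeasB.
  rewrite -(stationary T0 bh) -(Ex_cst m1 (S T h s)).
  by apply: Ex_dist_unif.
have h4 : Ex m (fun _ : config d => `|Ex m h - Ex m g|) <= e / 3.
  rewrite (Ex_cst m1) distrC; exact: le_trans (Ex_dist m1 bg bh) gh.
have -> : e = e / 3 + (e / 3 + e / 3) by field.
exact: lerD (le_trans h1 gh) (le_trans h2 (lerD h3 h4)).
Qed.

(** The second run, of length [T], starts from the discrete iterate [f1] and not from [S t f],
    because the oscillations of [f1] are explicitly contracted. Afterwards it is enough that [f1] is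
    close to [S t f], and [f2] to the constant [Ex m f], in $L^1(m)$. *)
Theorem semigroup_concentration f u (D t : R) : bmeas f -> osc_le f u -> 0 <= t ->
  (forall F, \sum_(i <- F) u i ^+ 2 <= D) ->
  Ex m (fun s => expR (S t f s)) <=
  expR (2 / (1 - q) * (expR (- (1 - q) * t) * D)) * expR (Ex m f).
Proof.
move=> bf fu t0 uD; have [_ q1] := andP q01; have k0 : 0 < 1 - q by rewrite subr_gt0.
have D0 : 0 <= D by have := uD fset0; rewrite big_nil.
set K := expR (2 / (1 - q) * _).
have [_ [M fM]] := bf.
have K0 : 0 < K := expR_gt0 _; have M0 := expR_gt0 M.
apply/ler_addgt0Pr => e e0.
(* Replacing [S t f] by [f1] costs [expR M * e1], replacing [f2] by its mean costs
   [expR M * (3 * e1)], multiplied by [K]; together they make up [e]. *)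
pose e1 := e / (expR M * (3 * K + 1)).
have e10 : 0 < e1 by rewrite divr_gt0// mulr_gt0// addr_gt0// mulr_gt0.
have bSf := semigroup_bmeas P t bf; have SfM := semigroup_norm P t bf fM.
have [T T0 HT] := mixing bSf e10.
rewrite (stationary t0 bf) in HT.
have [F1 HF1] := step_approx_L1 bf t0 e10.
have [F2 HF2] := step_approx_L1 bSf T0 e10.
(* Both runs share a window, because the sum over [F] bounded at the end of the first is the input
   of the second. *)
pose F := (F1 `|` F2)%fset.
have [n1 Hn1] := HF1 F (fsubsetUl _ _); have [n2 Hn2] := HF2 F (fsubsetUr _ _).
have [n3 Hn3] := fine_mesh_eventually F t0.
have [n4 Hn4] := fine_mesh_eventually F T0.
(* Ensures that [T / n * D] is at most 1/2, the smallness asked for by [Ex_expR_iter_step]. *)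
pose n5 := (Num.truncn (T * D * 2)).+1.
pose n := maxn n1 (maxn n2 (maxn n3 (maxn n4 n5))).
have {}Hn1 : _ := Hn1 n ltac:(by rewrite !leq_max leqnn).
have {}Hn2 : _ := Hn2 n ltac:(by rewrite !leq_max leqnn !orbT).
have fmt := Hn3 n ltac:(by rewrite !leq_max leqnn !orbT).
have fmT := Hn4 n ltac:(by rewrite !leq_max leqnn !orbT).
have Hn5 : (n5 <= n)%N by rewrite !leq_max leqnn !orbT.
have [nt01 ntF n0] := fmt; have [nT01 nTF _] := fmT.
have /andP[nt0 _] := nt01; have /andP[nT0 _] := nT01.
have np : 0 < n%:R :> R by rewrite ltr0n.
set f1 := iter n (step p F (t / n%:R)) f in Hn1.
have bf1 : bmeas f1 by exact: iter_step_bmeas.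
have f1M : forall s, `|f1 s| <= M by exact: iter_step_bound.
pose f2 := iter n (step p F (T / n%:R)) f1.
have bf2 : bmeas f2 by exact: iter_step_bmeas.
have f2M : forall s, `|f2 s| <= M by exact: iter_step_bound.
have of1 := iter_step_osc p01 pflip pC n nt0 ntF fu.
pose D1 := expR (- (1 - q) * t) * D.
have D1le : \sum_(i <- F) iter n (vstep C F (t / n%:R)) u i ^+ 2 <= D1.
  apply: le_trans (iter_vstep_l2 pC q01 Crow Ccol F u n nt01) _.
  apply: ler_pM => //; [|by apply: sumr_ge0 => i _; exact: sqr_ge0|exact: rate_pow fmt].
  by rewrite exprn_ge0// (rate_ge0 q01).
have D1D : D1 <= D.
  by rewrite ler_piMl// -[leRHS]expR0 ler_expR mulNr oppr_le0 mulr_ge0// ltW.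
have eD1 : T / n%:R * D1 <= 1 / 2.
  apply: (@le_trans _ _ (T / n%:R * D)); first by rewrite ler_wpM2l.
  rewrite mulrAC ler_pdivrMr// mulrAC mul1r ler_pdivlMr//.
  by rewrite (le_trans (ltW (truncnS_gt _)))// ler_nat.
have key := Ex_expR_iter_step m1 p01 pflip pql pC inv q01 Crow Ccol n nT01 nTF bf1 of1
  D1le eD1.
rewrite -/f2 -/K in key.
have bc := @bmeas_cst _ (config d) R (Ex m f).
have EfM : `|Ex m f| <= M.
  by apply: le_trans (Ex_norm m1 bf) _; apply: Ex_le_cst => //; exact: bmeas_norm.
have l1 := Ex_expR_lip m1 bSf bf1 SfM f1M.
have l2 := Ex_expR_lip m1 bf2 bc f2M (fun=> EfM).
rewrite (Ex_cst m1) in l2.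
have d1 : Ex m (fun s => `|S t f s - f1 s|) <= e1.
  rewrite (_ : (fun s => _) = fun s => `|f1 s - S t f s|)//.
  by apply/funext => s; rewrite distrC.
have bKS := iter_step_bmeas pql F (T / n%:R) n bSf.
have bSS := semigroup_bmeas P T bSf.
have d2 : Ex m (fun s => `|f2 s - Ex m f|) <= 3 * e1.
  have t1 := Ex_dist_tri m1 bf2 bKS bc.
  have t2 := Ex_dist_tri m1 bKS bSS bc.
  have t3 := iter_step_contract m1 p01 pql inv n nT0 nTF bf1 bSf.
  have -> : 3 * e1 = e1 + (e1 + e1) by ring.
  exact: le_trans t1 (lerD (le_trans t3 Hn1) (le_trans t2 (lerD Hn2 HT))).
have h1 := ler_wpM2l (ltW M0) d1; have h2 := ler_wpM2l (ltW M0) d2.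
have l2' := ler_wpM2l (ltW K0) (le_trans l2 (lerD (lexx _) h2)).
have eE : e = expR M * (3 * K + 1) * e1.
  by rewrite /e1 mulrC divfK// gt_eqF// mulr_gt0// addr_gt0// mulr_gt0.
rewrite [X in _ <= _ + X]eE; lra.
Qed.

End Concentration.

Section DeltaNorm.
Variables (R : realType) (d : nat).
Implicit Types (f : config d -> R) (i : site d) (s : config d).

Lemma flipK i s : flip i (flip i s) = s.
Proof.
by apply/funext => j; rewrite /flip eqxx negbK; case: eqVneq => // ->.
Qed.

Lemma deltaE f M i : (forall s, `|f s| <= M) -> delta f i = (fine (delta f i))%:E.
Proof.
move=> fM; rewrite fineK// fin_numElt; apply/andP; split.
  apply: (@lt_le_trans _ _ (f (flip i (fun=> false)) - f (fun=> false))%:E).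
    exact: ltNyr.
  by apply: ereal_sup_ubound; exists (fun=> false).
apply: (@le_lt_trans _ _ (2 * M)%:E); last exact: ltry.
apply: ge_ereal_sup => _ [s _ <-]; rewrite lee_fin.
have := fM s; have := fM (flip i s).
by rewrite !ler_norml => /andP[? ?] /andP[? ?]; lra.
Qed.

(** [delta] is a one-sided supremum; since [flip i] is an involution, it bounds the decrease as well
    as the increase. *)
Lemma osc_le_delta f M : (forall s, `|f s| <= M) ->
  osc_le f (fun i => fine (delta f i)).
Proof.
move=> fM i s.
have ub s' : f (flip i s') - f s' <= fine (delta f i).
  by rewrite -lee_fin -(deltaE i fM); apply: ereal_sup_ubound; exists s'.
rewrite ler_norml ub andbT.
by have := ub (flip i s); rewrite flipK; lra.
Qed.

Lemma delta_norm2_sqr f : (delta_norm2 f ^+ 2 = \esum_(i in [set: site d]) delta f i ^+ 2)%E.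
Proof.
rewrite /delta_norm2.
have : (0 <= \esum_(i in [set: site d]) delta f i ^+ 2)%E.
  by apply: esum_ge0 => i _; rewrite sqre_ge0.
case: (\esum_(i in _) _)%E => [x| |]//.
  by rewrite lee_fin => x0; rewrite poweR_EFin powR12_sqrt// -EFin_expe sqr_sqrtr.
by rewrite poweRyr ?invr_eq0 ?pnatr_eq0// expe2 mulyy.
Qed.

End DeltaNorm.

Theorem theorem3p3 (R : realType) (d : nat)
    (U : {fset site d} -> config d -> R)
    (mu : probability (config d) R)
    (P : R -> R.-pker (config d) ~> (config d)) :
  translation_invariant_interaction U ->
  gibbs_measure U mu ->
  translation_invariant mu ->
  dobrushin_condition U ->
  spin_flip_process (heat_bath_rate U) P ->
  exists c alpha : R, [/\ 0 < c, 0 < alpha &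
    forall (t : R) (f : config d -> R), 0 <= t ->
      measurable_fun [set: config d] f -> bounded_fun f ->
      ('E_mu[fun sigma => expR (semigroup P t f sigma - fine 'E_mu[f])] <=
       expeR ((c * expR (- alpha * t))%:E * delta_norm2 f ^+ 2))%E].
Proof.
move=> HU Hmu _ HD [HP HG].
have [q0 /andP[q00 q01] Csum] := dobrushin_sums HU HD.
(* The maximum keeps [q] positive even when the Dobrushin matrix vanishes; [weighted_cauchy_schwarz]
   divides by it. *)
pose q := Num.max q0 (1 / 2).
have q0q : q0 <= q by rewrite le_max lexx.
have q12 : 1 / 2 <= q by rewrite le_max lexx orbT.
have Hq : 0 < q < 1.
  apply/andP; split; first by apply: lt_le_trans q12; lra.
  by rewrite gt_max q01; lra.
have [qp q1] := andP Hq; have k0 : 0 < 1 - q by rewrite subr_gt0.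
pose p i s := site_cond U i true s.
have m1 : mu setT = 1%E := probability_setT mu.
have p01 i s : 0 <= p i s <= 1 by rewrite site_cond_ge0 site_cond_le1.
have falseE i s : site_cond U i false s = 1 - p i s.
  by rewrite -(site_cond_sum U i s) addrC addKr.
(* Resampling changes the configuration only when the opposite spin is drawn, and the heat bath rate
   is the probability of that spin. *)
have cE i (f : config d -> R) s :
    heat_bath_rate U i s * (f (flip i s) - f s) = resample p i f s - f s.
  rewrite /heat_bath_rate /resample !set_spinE {1}/flip eqxx.
  by case: (s i) => /=; rewrite ?falseE /p; ring.
have Crow (F : {fset site d}) i : \sum_(j <- F) dobrushin U i j <= q.
  by apply: le_trans q0q; exact: (Csum F).1.
have Ccol (F : {fset site d}) j : \sum_(i <- F) dobrushin U i j <= q.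
  by apply: le_trans q0q; exact: (Csum F).2.
exists (2 / (1 - q)), (1 - q); split => //; first by rewrite divr_gt0.
move=> t f t0 mf [M0 [_ fM0]].
have M0lt : M0 < `|M0| + 1 by rewrite (le_lt_trans (ler_norm _))// ltrDl.
have {M0lt} fM s := fM0 _ M0lt s Logic.I; set M := `|M0| + 1 in fM.
have bf : bmeas f by split => //; exists M.
rewrite delta_norm2_sqr.
have sumE0 : (0 <= \esum_(i in [set: site d]) delta f i ^+ 2)%E.
  by apply: esum_ge0 => i _; rewrite sqre_ge0.
(* With a positive coefficient the right-hand side is infinite as soon as the sum of squares is. *)
have cpos : 0 < 2 / (1 - q) * expR (- (1 - q) * t).
  by rewrite mulr_gt0 ?expR_gt0// divr_gt0.
case Esum : (\esum_(i in [set: site d]) delta f i ^+ 2)%E sumE0 => [x| |]//; last first.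
  by move=> _; rewrite gt0_muley ?lte_fin//= leey.
move=> _; set u := fun i => fine (delta f i).
have ux (F : {fset site d}) : \sum_(i <- F) u i ^+ 2 <= x.
  rewrite -lee_fin -Esum; apply: esum_ge; exists [set` F] => //.
  rewrite fsbig_finite//= set_fsetK -sumEFin; apply: lee_sum => i _.
  by rewrite [in leRHS](deltaE i fM) -EFinM -expr2.
have main := semigroup_concentration HP HG cE p01 (fun i s => site_cond_flip U i true s)
  (site_cond_quasilocal HU) (fun i j s => site_cond_dobrushin U i j true s)
  Hq Crow Ccol m1 (gibbs_resample HU Hmu) bf (osc_le_delta fM) t0 ux.
have bS := semigroup_bmeas P t bf.
rewrite expectation.unlock -/(Ex mu f) (ExE m1); last first.
  by apply: bmeas_expR; apply: bmeasB => //; exact: bmeas_cst.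
rewrite -EFinM /= lee_fin.
rewrite (_ : (fun s => expR (semigroup P t f s - Ex mu f)) =
    fun s => expR (- Ex mu f) * expR (semigroup P t f s)); last first.
  by apply/funext => s; rewrite expRD mulrC.
rewrite (ExZ m1); last exact: bmeas_expR.
rewrite expRN mulrC ler_pdivrMr ?expR_gt0//.
by move: main; rewrite mulrA.
Qed.
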